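(* Consider the problem $$\text{(P)}\qquad \min_{x\in\mathbb{R}^n,\,z\in\mathbb{R}^m}\ \tfrac12 x^TPx+q^Tx \quad\text{s.t.}\quad Ax=z,\ z\in\mathcal{C},$$ where $P\in\mathbb{R}^{n\times n}$ is symmetric positive semidefinite, $q\in\mathbb{R}^n$, $A\in\mathbb{R}^{m\times n}$, and $\mathcal{C}\subseteq\mathbb{R}^m$ is a nonempty closed convex set that is the Cartesian product of a compact convex set and a translate of a closed convex cone. Let $(x^k,z^k,y^k)_{k\in\mathbb{N}}$ be generated by the approximate ADMM algorithm described in the context (with $\rho>0$, $\sigma>0$, $\alpha\in(0,2)$, arbitrary initial values and nonnegative summable error sequences $(\mu^k),(\nu^k)$). Then: (a) If (P) has a KKT point, then $(x^k,z^k,y^k)$ converges to a KKT point of (P). (b) In all cases the limits $\delta x\coloneqq\lim_{k\to\infty}(x^{k+1}-x^k)$ and $\delta y\coloneqq\lim_{k\to\infty}(y^{k+1}-y^k)$ exist, and: (i) if $\delta y\neq 0$, then (P) is primal infeasible and $\delta y$ is a certificate of primal infeasibility, i.e. $A^T\delta y=0$ and $S_{\mathcal{C}}(\delta y)<0$; (ii) if $\delta x\neq 0$, then (P) is dual infeasible and $\delta x$ is a certificate of dual infeasibility, i.e. $P\delta x=0$, $A\delta x\in\mathcal{C}^\infty$ and $q^T\delta x<0$; (iii) if both $\delta x\neq0$ and $\delta y\neq 0$, then (P) is both primal and dual infeasible, with $\delta y$ and $\delta x$ certificates as in (i) and (ii).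
   Context: Approximate ADMM algorithm: given $x^0\in\mathbb{R}^n$, $z^0,y^0\in\mathbb{R}^m$, parameters $\rho>0,\sigma>0,\alpha\in(0,2)$ and nonnegative summable sequences $(\mu^k)_{k\in\mathbb{N}},(\nu^k)_{k\in\mathbb{N}}$, for $k=0,1,\dots$: 1. choose $(\tilde x^{k+1},\tilde z^{k+1})$ with $\|(\tilde x^{k+1},\tilde z^{k+1})-(\hat x,\hat z)\|_2\le\mu^k$, where $(\hat x,\hat z)$ is the exact solution of the linear system $\begin{bmatrix}P+\sigma I & \rho A^T\\ \rho A & -\rho I\end{bmatrix}\begin{bmatrix}\hat x\\ \hat z\end{bmatrix}=\begin{bmatrix}\sigma x^k+\rho A^T(z^k-y^k/\rho)-q\\ 0\end{bmatrix}$; 2. $x^{k+1}=\alpha\tilde x^{k+1}+(1-\alpha)x^k$; 3. choose $z^{k+1}$ with $\|z^{k+1}-\Pi_{\mathcal{C}}(\alpha\tilde z^{k+1}+(1-\alpha)z^k+y^k/\rho)\|_2\le\nu^k$, where $\Pi_{\mathcal{C}}$ is the Euclidean projection onto $\mathcal{C}$; 4. $y^{k+1}=y^k+\rho(\alpha\tilde z^{k+1}+(1-\alpha)z^k-z^{k+1})$. A KKT point of (P) is a triple $(\bar x,\bar z,\bar y)$ with $P\bar x+q+A^T\bar y=0$, $A\bar x=\bar z$, $\bar z\in\mathcal{C}$, and $\bar y$ in the normal cone of $\mathcal{C}$ at $\bar z$. $S_{\mathcal{C}}(y)=\sup_{z\in\mathcal{C}}\langle y,z\rangle$ is the support function of $\mathcal{C}$,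 and $\mathcal{C}^\infty$ denotes the recession cone of $\mathcal{C}$. *)

(* Defs.v *)
(* classical reals. Vectors in R^d are functions nat -> R, of
   which only the coordinates i < d matter; matrices are nat -> nat -> R. *)
From Stdlib Require Import Reals Lra.
Open Scope R_scope.

Definition vec := nat -> R.
Definition mat := nat -> nat -> R.

Fixpoint fsum (d : nat) (f : nat -> R) : R :=
  match d with
  | O => 0
  | S k => fsum k f + f k
  end.

Definition inner (d : nat) (u v : vec) : R := fsum d (fun i => u i * v i).
Definition norm2 (d : nat) (u : vec) : R := sqrt (inner d u u).

Definition mv (r c : nat) (A : mat) (x : vec) : vec :=
  fun i => fsum c (fun j => A i j * x j).
Definition mtv (r c : nat) (A : mat) (y : vec) : vec :=
  fun j => fsum r (fun i => A i j * y i).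

Definition veq (d : nat) (u v : vec) : Prop := forall i, (i < d)%nat -> u i = v i.
Definition vnonzero (d : nat) (u : vec) : Prop := exists i, (i < d)%nat /\ u i <> 0.
Definition vcv (d : nat) (s : nat -> vec) (l : vec) : Prop :=
  forall i, (i < d)%nat -> Un_cv (fun k => s k i) (l i).

Definition closedR (d : nat) (S : vec -> Prop) : Prop :=
  forall (s : nat -> vec) (l : vec), (forall k, S (s k)) -> vcv d s l -> S l.
Definition convexR (S : vec -> Prop) : Prop :=
  forall u v t, S u -> S v -> 0 <= t <= 1 -> S (fun i => t * u i + (1 - t) * v i).
Definition nonemptyR (S : vec -> Prop) : Prop := exists u, S u.
Definition boundedR (d : nat) (S : vec -> Prop) : Prop :=
  exists B, forall u, S u -> forall i, (i < d)%nat -> Rabs (u i) <= B.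
Definition compactR (d : nat) (S : vec -> Prop) : Prop :=
  closedR d S /\ boundedR d S.
Definition coneR (K : vec -> Prop) : Prop :=
  forall u t, K u -> 0 <= t -> K (fun i => t * u i).

Definition compact_times_cone (m : nat) (C : vec -> Prop) : Prop :=
  exists (m1 : nat) (C1 K : vec -> Prop) (b : vec),
    (m1 <= m)%nat /\
    compactR m1 C1 /\ convexR C1 /\ nonemptyR C1 /\
    closedR (m - m1) K /\ convexR K /\ coneR K /\ nonemptyR K /\
    forall z, C z <-> (C1 z /\ K (fun i => z (m1 + i)%nat - b i)).

Definition is_proj (m : nat) (C : vec -> Prop) (w p : vec) : Prop :=
  C p /\ forall c, C c -> norm2 m (fun i => w i - p i) <= norm2 m (fun i => w i - c i).

Definition in_normal_cone (m : nat) (C : vec -> Prop) (z y : vec) : Prop :=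
  forall c, C c -> inner m y (fun i => c i - z i) <= 0.

Definition in_recession_cone (C : vec -> Prop) (d : vec) : Prop :=
  forall c t, C c -> 0 <= t -> C (fun i => c i + t * d i).

Definition support_neg (m : nat) (C : vec -> Prop) (y : vec) : Prop :=
  exists s, s < 0 /\ forall c, C c -> inner m y c <= s.
Definition support_finite (m : nat) (C : vec -> Prop) (y : vec) : Prop :=
  exists s, forall c, C c -> inner m y c <= s.

Definition psd (n : nat) (P : mat) : Prop :=
  (forall i j, (i < n)%nat -> (j < n)%nat -> P i j = P j i) /\
  (forall x, 0 <= inner n x (mv n n P x)).

Definition is_KKT (n m : nat) (P : mat) (q : vec) (A : mat) (C : vec -> Prop)
  (xb zb yb : vec) : Prop :=
  veq n (fun i => mv n n P xb i + q i + mtv m n A yb i) (fun _ => 0) /\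
  veq m (mv m n A xb) zb /\
  C zb /\
  in_normal_cone m C zb yb.

Definition primal_feasible (n m : nat) (A : mat) (C : vec -> Prop) : Prop :=
  exists x, C (mv m n A x).
Definition dual_feasible (n m : nat) (P : mat) (q : vec) (A : mat) (C : vec -> Prop) : Prop :=
  exists x y, veq n (fun i => mv n n P x i + mtv m n A y i + q i) (fun _ => 0) /\
              support_finite m C y.

Definition summable_nonneg (s : nat -> R) : Prop :=
  (forall k, 0 <= s k) /\ exists l, infinite_sum s l.

(* (x,z,y) generated by the approximate ADMM algorithm, with chosen
   intermediate points xt k.+1 = tilde x^{k+1}, zt k.+1 = tilde z^{k+1}. *)
Definition admm_iterates (n m : nat) (P : mat) (q : vec) (A : mat) (C : vec -> Prop)
  (rho sigma alpha : R) (mu nu : nat -> R) (x z y xt zt : nat -> vec) : Prop :=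
  forall k,
    (exists xh zh : vec,
       veq n (fun i => mv n n P xh i + sigma * xh i + rho * mtv m n A zh i)
             (fun i => sigma * x k i + rho * mtv m n A (fun l => z k l - y k l / rho) i - q i) /\
       veq m (fun i => rho * mv m n A xh i - rho * zh i) (fun _ => 0) /\
       sqrt (fsum n (fun i => (xt (S k) i - xh i) ^ 2) +
             fsum m (fun i => (zt (S k) i - zh i) ^ 2)) <= mu k) /\
    veq n (x (S k)) (fun i => alpha * xt (S k) i + (1 - alpha) * x k i) /\
    (exists p, is_proj m C
                 (fun i => alpha * zt (S k) i + (1 - alpha) * z k i + y k i / rho) p /\
               norm2 m (fun i => z (S k) i - p i) <= nu k) /\
    veq m (y (S k))
        (fun i => y k i + rho * (alpha * zt (S k) i + (1 - alpha) * z k i - z (S k) i)).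

(* Main.v *)
(* With [v = z + y / rho] the algorithm is a perturbed Douglas-Rachford iteration
   [s <- T s + error] for the state [s = (x, v)], and [T] is averaged for the inner product
   weighting [x] by [sigma] and [v] by [rho].  If (P) has a KKT point, [T] has a fixed point,
   and the iterates are quasi-Fejer monotone, hence converge.  In general the increments of
   every trajectory of [T] converge to one vector [delta], which satisfies
   [<T s - s, delta> >= |delta|^2] for all [s]; summable errors do not change the limit.

   For the certificates, put [dx] for the [x]-part and [dv] for the [v]-part of [delta],
   [dz = A dx] and [dy = rho (dv - dz)].  Dividing the optimality conditions by the iteration
   count gives [P dx = 0], [A^T dy = 0], [<dy, dz> = 0] and that [dz] is a recession direction.
   The optimality condition tested with [dx] gives
   [q^T dx >= - (sigma |dx|^2 + rho |dz|^2) / alpha], the relation [A xt = zt] tested with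
   [dy] gives [sup_C <dy, .> >= - |dy|^2 / (alpha rho)], and the inequality for [delta] at
   [s = (0, c)], [c] in [C], bounds the sum [q^T dx + sup_C <dy, .>] by the sum of these two
   lower bounds.  So both are equalities. *)

Require Import Defs.
From Stdlib Require Import Reals Lra Lia Psatz FunctionalExtensionality ClassicalEpsilon.
Open Scope R_scope.

(** The hard step is that increments converge even when [T] has no fixed point. Their norms
    decrease, say to [r], and averagedness makes consecutive increments asymptotically equal, so
    every displacement over [p] steps has norm at least [p r]. Hence, for suitable large [p], the
    [p]-th increment has inner product almost at least [r^2] with the mean displacement over [p]
    steps. As [T - id] is dissipative, this passes to every earlier increment up to an error of
    order [1 / p]; since the mean is no longer than the first increment, all increments lie close to
    it when the first norm is close to [r]. The same dissipativity, between [s_k] and [s_0] and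
    divided by [k], yields the inequality for [delta].

    Errors are handled by shadowing: a nonexpansive map does not amplify them, so an exact
    trajectory started late stays uniformly close to the iterates.

    Since [z^0] and [y^0] are arbitrary, states are recorded only from the first step on. From there
    the [y]-update makes [v] the very point that was projected, so [z] is the projection of [v] up
    to [nu]. *)

Definition vadd (u v : vec) : vec := fun i => u i + v i.
Definition vsub (u v : vec) : vec := fun i => u i - v i.
Definition vscal (a : R) (u : vec) : vec := fun i => a * u i.

Lemma fun_choice {A B : Type} (R : A -> B -> Prop) :
  (forall a, exists b, R a b) -> exists f : A -> B, forall a, R a (f a).
Proof.
  intros H.
  exists (fun a => proj1_sig (constructive_indefinite_description _ (H a))).
  intros a; apply proj2_sig.
Qed.

(** * Finite sums and limits *)

Lemma fsum_ext d f g : (forall i, (i < d)%nat -> f i = g i) -> fsum d f = fsum d g.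
Proof.
  induction d as [|d IH]; simpl; intros H; [reflexivity|].
  rewrite IH, H by (intros; try apply H; lia); reflexivity.
Qed.

Lemma fsum_lin d a b f g :
  fsum d (fun i => a * f i + b * g i) = a * fsum d f + b * fsum d g.
Proof. induction d as [|d IH]; simpl; [|rewrite IH]; ring. Qed.

Lemma fsum_scal d a f : fsum d (fun i => a * f i) = a * fsum d f.
Proof. induction d as [|d IH]; simpl; [|rewrite IH]; ring. Qed.

Lemma fsum_nonneg d f : (forall i, (i < d)%nat -> 0 <= f i) -> 0 <= fsum d f.
Proof.
  induction d as [|d IH]; simpl; intros H; [lra|].
  specialize (IH (fun i h => H i (Nat.lt_trans _ _ _ h (Nat.lt_succ_diag_r d)))).
  specialize (H d (Nat.lt_succ_diag_r d)); lra.
Qed.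

Lemma fsum_ge_term d f i :
  (forall j, (j < d)%nat -> 0 <= f j) -> (i < d)%nat -> f i <= fsum d f.
Proof.
  induction d as [|d IH]; simpl; intros H hi; [lia|].
  destruct (Nat.eq_dec i d) as [->|ne].
  - assert (0 <= fsum d f) by (apply fsum_nonneg; intros; apply H; lia); lra.
  - assert (f i <= fsum d f) by (apply IH; [intros; apply H|]; lia).
    specialize (H d (Nat.lt_succ_diag_r d)); lra.
Qed.

Lemma fsum_swap r c (f : nat -> nat -> R) :
  fsum r (fun i => fsum c (fun j => f i j)) = fsum c (fun j => fsum r (fun i => f i j)).
Proof.
  induction r as [|r IH]; simpl.
  - symmetry; induction c as [|c IH]; simpl; [|rewrite IH]; ring.
  - rewrite IH; symmetry.
    transitivity (fsum c (fun j => 1 * fsum r (fun i => f i j) + 1 * f r j)).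
    + apply fsum_ext; intros; ring.
    + rewrite (fsum_lin c 1 1 (fun j => fsum r (fun i => f i j)) (fun j => f r j)); ring.
Qed.

Lemma fsum_split n m f : fsum (n + m) f = fsum n f + fsum m (fun i => f (n + i)%nat).
Proof.
  induction m as [|m IH]; [rewrite Nat.add_0_r|rewrite Nat.add_succ_r]; simpl;
    [|rewrite IH]; ring.
Qed.

Lemma Un_cv_const c : Un_cv (fun _ => c) c.
Proof. intros e he; exists O; intros; rewrite R_dist_eq; exact he. Qed.

Lemma Un_cv_ext u v l : (forall k, u k = v k) -> Un_cv u l -> Un_cv v l.
Proof.
  intros H h e he; destruct (h e he) as [N hN]; exists N; intros k hk.
  rewrite <- H; auto.
Qed.

Lemma Un_cv_limit_ext u l l' : Un_cv u l -> l = l' -> Un_cv u l'.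
Proof. intros h <-; exact h. Qed.

Lemma Un_cv_scal a u l : Un_cv u l -> Un_cv (fun k => a * u k) (a * l).
Proof. intros h; apply (CV_mult (fun _ => a) u a l (Un_cv_const a) h). Qed.

Lemma Un_cv_ge u l c : Un_cv u l -> (forall k, c <= u k) -> c <= l.
Proof. intros h hc; apply (Rle_cv_lim (fun k => hc k) (Un_cv_const c) h). Qed.

Lemma Un_cv_comp u l (f : nat -> nat) :
  (forall k, (k <= f k)%nat) -> Un_cv u l -> Un_cv (fun k => u (f k)) l.
Proof.
  intros hf h e he; destruct (h e he) as [N hN]; exists N; intros k hk.
  apply hN; specialize (hf k); lia.
Qed.

Lemma Un_cv_unshift u l : Un_cv (fun k => u (S k)) l -> Un_cv u l.
Proof.
  intros h e he; destruct (h e he) as [N hN]; exists (S N); intros [|k] hk; [lia|].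
  apply hN; lia.
Qed.

Lemma Un_cv_squeeze0 u v : (forall k, Rabs (u k) <= v k) -> Un_cv v 0 -> Un_cv u 0.
Proof.
  intros H h e he; destruct (h e he) as [N hN]; exists N; intros k hk.
  specialize (hN k hk); unfold R_dist in *; rewrite Rminus_0_r in *.
  specialize (H k); pose proof (Rle_abs (v k)); lra.
Qed.

Lemma fsum_cv d (f : nat -> nat -> R) (l : nat -> R) :
  (forall i, (i < d)%nat -> Un_cv (fun k => f k i) (l i)) ->
  Un_cv (fun k => fsum d (f k)) (fsum d l).
Proof.
  induction d as [|d IH]; simpl; intros H; [apply Un_cv_const|].
  apply (CV_plus (fun k => fsum d (f k)) (fun k => f k d)); auto.
Qed.

(** Telescoping writes [a k / INR k] as the Cesaro mean of the increments plus [a 0 / INR k]. *)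
Lemma cv_average (a : nat -> R) l :
  Un_cv (fun k => a (S k) - a k) l -> Un_cv (fun k => a k / INR k) l.
Proof.
  intros h.
  assert (h1 := Cesaro_1 _ _ h).
  assert (h0 : Un_cv (fun k => a O * / INR k) 0).
  { apply Un_cv_limit_ext with (a O * 0); [|ring].
    apply Un_cv_scal.
    apply (cv_infty_cv_0 (fun k => INR k)).
    - intros M; destruct (INR_unbounded M) as [N hN]; exists N; intros k hk.
      apply le_INR in hk; lra. }
  assert (h2 := CV_plus _ _ _ _ h1 h0); rewrite Rplus_0_r in h2.
  intros e he; destruct (h2 e he) as [N hN]; exists (S N); intros k hk.
  specialize (hN k ltac:(lia)).
  replace (a k / INR k) with
    (sum_f_R0 (fun j => a (S j) - a j) (pred k) / INR k + a O * / INR k); [exact hN|].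
  assert (tel : forall j, sum_f_R0 (fun j => a (S j) - a j) j = a (S j) - a O).
  { induction j as [|j IH]; simpl; [|rewrite IH]; ring. }
  rewrite tel; destruct k as [|k]; [lia|]; simpl pred; unfold Rdiv; ring.
Qed.

(** * Weighted inner products *)

(** The weight is a parameter so that the same lemmas serve the Euclidean products, with weight 1,
    and the product on states, with weights [sigma] and [rho] on the two blocks. *)
Definition wip (d : nat) (w : nat -> R) (u v : vec) : R :=
  fsum d (fun i => w i * (u i * v i)).
Definition wnorm (d : nat) (w : nat -> R) (u : vec) : R := sqrt (wip d w u u).

Section WeightedInnerProduct.
Context {d : nat} {w : nat -> R} (Hw : forall i, 0 < w i).

Lemma wip_ext u u' v v' : veq d u u' -> veq d v v' -> wip d w u v = wip d w u' v'.
Proof. intros hu hv; apply fsum_ext; intros i hi; rewrite hu, hv by exact hi; ring. Qed.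

Lemma wip_sym u v : wip d w u v = wip d w v u.
Proof. apply fsum_ext; intros; ring. Qed.

Lemma wip_add_l u v c : wip d w (vadd u v) c = wip d w u c + wip d w v c.
Proof. unfold wip, vadd; induction d as [|e IH]; simpl; [ring|rewrite IH; ring]. Qed.
Lemma wip_sub_l u v c : wip d w (vsub u v) c = wip d w u c - wip d w v c.
Proof. unfold wip, vsub; induction d as [|e IH]; simpl; [ring|rewrite IH; ring]. Qed.
Lemma wip_scal_l a u c : wip d w (vscal a u) c = a * wip d w u c.
Proof. unfold wip, vscal; induction d as [|e IH]; simpl; [ring|rewrite IH; ring]. Qed.
Lemma wip_add_r u v c : wip d w c (vadd u v) = wip d w c u + wip d w c v.
Proof. rewrite !(wip_sym c); apply wip_add_l. Qed.
Lemma wip_sub_r u v c : wip d w c (vsub u v) = wip d w c u - wip d w c v.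
Proof. rewrite !(wip_sym c); apply wip_sub_l. Qed.
Lemma wip_scal_r a u c : wip d w c (vscal a u) = a * wip d w c u.
Proof. rewrite !(wip_sym c); apply wip_scal_l. Qed.

Lemma wip_zero_r u v : veq d v (fun _ => 0) -> wip d w u v = 0.
Proof.
  intros h; rewrite (wip_ext u u v (vscal 0 v)), wip_scal_r; [ring| |].
  - intros i hi; reflexivity.
  - intros i hi; unfold vscal; rewrite (h i hi); ring.
Qed.

Lemma wip_nonneg u : 0 <= wip d w u u.
Proof. apply fsum_nonneg; intros i _; pose proof (Hw i); nra. Qed.

Lemma wip_ge_term u i : (i < d)%nat -> w i * (u i * u i) <= wip d w u u.
Proof.
  apply (fsum_ge_term d (fun i => w i * (u i * u i))); intros j _.
  pose proof (Hw j); nra.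
Qed.

Lemma wip_zero u : wip d w u u <= 0 -> veq d u (fun _ => 0).
Proof.
  intros h i hi; pose proof (wip_ge_term u i hi); pose proof (Hw i).
  destruct (Req_dec (u i) 0) as [|ne]; [assumption|].
  assert (0 < w i * (u i * u i)); [|lra].
  apply Rmult_lt_0_compat; [assumption|nra].
Qed.

Lemma wnorm_nonneg u : 0 <= wnorm d w u.
Proof. apply sqrt_pos. Qed.

Lemma wnorm_sq u : wnorm d w u * wnorm d w u = wip d w u u.
Proof. apply sqrt_sqrt, wip_nonneg. Qed.

Lemma wnorm_le u b : 0 <= b -> wip d w u u <= b * b -> wnorm d w u <= b.
Proof.
  intros hb h; rewrite <- (sqrt_square b hb); apply sqrt_le_1_alt; exact h.
Qed.

Lemma cauchy_schwarz u v : wip d w u v <= wnorm d w u * wnorm d w v.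
Proof.
  pose proof (wnorm_nonneg u) as hu; pose proof (wnorm_nonneg v) as hv.
  pose proof (wnorm_sq u) as qu; pose proof (wnorm_sq v) as qv.
  set (a := wnorm d w u) in *; set (b := wnorm d w v) in *.
  (* With [a], [b] the norms, expanding the square of [b u - a v] gives [2 a b (a b - <u, v>) >= 0].
     Zero norms are treated apart because [a b] is cancelled. *)
  pose proof (wip_nonneg (vsub (vscal b u) (vscal a v))) as h.
  repeat rewrite ?wip_sub_l, ?wip_sub_r, ?wip_scal_l, ?wip_scal_r in h.
  rewrite (wip_sym v u), <- qu, <- qv in h.
  destruct (Req_dec a 0) as [za|na].
  { pose proof (wip_zero u ltac:(rewrite <- qu, za; lra)) as zu.
    rewrite za, wip_sym, wip_zero_r by exact zu; lra. }
  destruct (Req_dec b 0) as [zb|nb].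
  { pose proof (wip_zero v ltac:(rewrite <- qv, zb; lra)) as zv.
    rewrite zb, wip_zero_r by exact zv; lra. }
  assert (0 < a * b) by (apply Rmult_lt_0_compat; lra).
  apply Rmult_le_reg_l with (a * b); [assumption|].
  nra.
Qed.

Lemma wip_le_norms u v a b :
  0 <= a -> 0 <= b -> wip d w u u <= a * a -> wip d w v v <= b * b -> wip d w u v <= a * b.
Proof.
  intros ha hb hu hv; eapply Rle_trans; [apply cauchy_schwarz|].
  apply Rmult_le_compat; try apply wnorm_nonneg; apply wnorm_le; assumption.
Qed.

Lemma wnorm_ext u v : veq d u v -> wnorm d w u = wnorm d w v.
Proof. intros h; unfold wnorm; f_equal; apply wip_ext; exact h. Qed.

Lemma wnorm_add u v : wnorm d w (vadd u v) <= wnorm d w u + wnorm d w v.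
Proof.
  pose proof (wnorm_nonneg u); pose proof (wnorm_nonneg v).
  apply wnorm_le; [lra|].
  pose proof (cauchy_schwarz u v); pose proof (wnorm_sq u); pose proof (wnorm_sq v).
  rewrite !wip_add_l, !wip_add_r, (wip_sym v u); nra.
Qed.

Lemma wnorm_scal a u : wnorm d w (vscal a u) = Rabs a * wnorm d w u.
Proof.
  unfold wnorm; rewrite wip_scal_l, wip_scal_r, <- Rmult_assoc.
  rewrite sqrt_mult_alt by nra; f_equal; apply sqrt_Rsqr_abs.
Qed.

Lemma wnorm_sub_sym u v : wnorm d w (vsub u v) = wnorm d w (vsub v u).
Proof.
  unfold wnorm; f_equal; rewrite !wip_sub_l, !wip_sub_r, (wip_sym v u); ring.
Qed.

Lemma wnorm_triangle a b c :
  wnorm d w (vsub a c) <= wnorm d w (vsub a b) + wnorm d w (vsub b c).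
Proof.
  rewrite (wnorm_ext (vsub a c) (vadd (vsub a b) (vsub b c))); [apply wnorm_add|].
  intros i _; unfold vsub, vadd; ring.
Qed.

Lemma wnorm_sub_le a b : wnorm d w a <= wnorm d w b + wnorm d w (vsub a b).
Proof.
  rewrite (wnorm_ext a (vadd b (vsub a b))); [apply wnorm_add|].
  intros i _; unfold vsub, vadd; ring.
Qed.

Lemma coord_le_wnorm u i : (i < d)%nat -> Rabs (u i) <= / sqrt (w i) * wnorm d w u.
Proof.
  intros hi; pose proof (sqrt_lt_R0 _ (Hw i)) as hs.
  apply Rmult_le_reg_l with (sqrt (w i)); [exact hs|].
  rewrite <- Rmult_assoc, Rinv_r, Rmult_1_l by lra.
  rewrite <- (sqrt_Rsqr_abs (u i)), <- sqrt_mult_alt by (left; apply Hw).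
  apply sqrt_le_1_alt, wip_ge_term, hi.
Qed.

Lemma wip_cv s t a b :
  vcv d s a -> vcv d t b -> Un_cv (fun k => wip d w (s k) (t k)) (wip d w a b).
Proof.
  intros hs ht; apply (fsum_cv d (fun k i => w i * (s k i * t k i))).
  intros i hi; apply Un_cv_scal, CV_mult; auto.
Qed.

Lemma vcv_sub s t a b : vcv d s a -> vcv d t b -> vcv d (fun k => vsub (s k) (t k)) (vsub a b).
Proof. intros hs ht i hi; apply (CV_minus (fun k => s k i) (fun k => t k i)); auto. Qed.

Lemma vcv_const a : vcv d (fun _ => a) a.
Proof. intros i hi; apply Un_cv_const. Qed.

Lemma vcv_wnorm s l : vcv d s l -> Un_cv (fun k => wnorm d w (vsub (s k) l)) 0.
Proof.
  intros hs.
  assert (h : vcv d (fun k => vsub (s k) l) (vsub l l)) by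
    (apply vcv_sub; [exact hs | apply vcv_const]).
  pose proof (wip_cv _ _ _ _ h h) as hq.
  rewrite wip_sub_l, Rminus_diag in hq.
  intros e he; destruct (hq (e * e)) as [N hN]; [nra|].
  exists N; intros k hk; specialize (hN k hk).
  unfold R_dist in *; rewrite Rminus_0_r in *.
  pose proof (wnorm_sq (vsub (s k) l)); pose proof (wnorm_nonneg (vsub (s k) l)).
  rewrite Rabs_pos_eq in * by (try apply wip_nonneg; assumption); nra.
Qed.

Lemma wnorm_vcv s l : Un_cv (fun k => wnorm d w (vsub (s k) l)) 0 -> vcv d s l.
Proof.
  intros h i hi.
  assert (h0 : Un_cv (fun k => s k i - l i) 0).
  { apply Un_cv_squeeze0 with (fun k => / sqrt (w i) * wnorm d w (vsub (s k) l)).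
    - intros k; apply (coord_le_wnorm (vsub (s k) l) i hi).
    - rewrite <- (Rmult_0_r (/ sqrt (w i))); apply Un_cv_scal, h. }
  apply Un_cv_ext with (fun k => (s k i - l i) + l i); [intros; ring|].
  apply Un_cv_limit_ext with (0 + l i); [|ring].
  apply (CV_plus _ (fun _ => l i)); [exact h0|apply Un_cv_const].
Qed.

Lemma wnorm_complete s :
  (forall e, 0 < e -> exists N, forall j k, (N <= j)%nat -> (N <= k)%nat ->
     wip d w (vsub (s j) (s k)) (vsub (s j) (s k)) <= e) ->
  exists l, vcv d s l.
Proof.
  intros hC.
  assert (H : forall i, exists c, (i < d)%nat -> Un_cv (fun k => s k i) c).
  { intros i; destruct (Nat.lt_ge_cases i d) as [hi|hi]; [|exists 0; lia].
    destruct (R_complete (fun k => s k i)) as [c hc]; [|exists c; auto].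
    intros e he; destruct (hC (w i * (e * e) / 2)) as [N hN].
    { apply Rdiv_lt_0_compat; [|lra]; apply Rmult_lt_0_compat; [apply Hw|nra]. }
    exists N; intros j k hj hk; specialize (hN j k hj hk).
    pose proof (wip_ge_term (vsub (s j) (s k)) i hi) as ht.
    unfold R_dist; unfold vsub at 1 2 in ht.
    assert ((s j i - s k i) * (s j i - s k i) < e * e).
    { apply Rmult_lt_reg_l with (w i); [apply Hw|].
      assert (0 < w i * (e * e)) by (apply Rmult_lt_0_compat; [apply Hw|nra]); lra. }
    apply Rabs_def1; nra. }
  destruct (fun_choice _ H) as [l hl]; exists l; exact hl.
Qed.

End WeightedInnerProduct.

(** * Compactness of bounded sequences *)

Lemma bolzano_weierstrass_R (u : nat -> R) B :
  (forall k, Rabs (u k) <= B) ->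
  exists (f : nat -> nat) l, (forall k, (k <= f k)%nat) /\ Un_cv (fun k => u (f k)) l.
Proof.
  intros hB.
  destruct (Bolzano_Weierstrass u (fun c => - B <= c <= B)) as [l hl].
  - apply compact_P3.
  - intros k; specialize (hB k); unfold Rabs in hB; destruct Rcase_abs; lra.
  - assert (H : forall k, exists p, (k <= p)%nat /\ Rabs (u p - l) < / INR (S k)).
    { intros k.
      assert (pk : 0 < / INR (S k)) by (apply Rinv_0_lt_compat, lt_0_INR; lia).
      destruct (hl (disc l (mkposreal _ pk)) k) as [p [hp hd]].
      - exists (mkposreal _ pk); intros c hc; exact hc.
      - exists p; split; [exact hp|exact hd]. }
    destruct (fun_choice _ H) as [f hf]; exists f, l; split; [intros k; apply hf|].
    intros e he; destruct (archimed_cor1 e he) as [N [hN hN0]]; exists N; intros k hk.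
    apply Rlt_trans with (/ INR (S k)); [apply hf|].
    apply Rle_lt_trans with (/ INR N); [|exact hN].
    apply Rinv_le_contravar; [apply lt_0_INR; lia|apply le_INR; lia].
Qed.

(** Coordinates are treated one at a time, each extraction refining the previous one. A selector
    need only satisfy [k <= f k]: this preserves limits and survives composition. *)
Lemma bolzano_weierstrass d (s : nat -> vec) B :
  (forall k i, (i < d)%nat -> Rabs (s k i) <= B) ->
  exists (f : nat -> nat) l, (forall k, (k <= f k)%nat) /\ vcv d (fun k => s (f k)) l.
Proof.
  induction d as [|d IH]; intros hB.
  - exists (fun k => k), (fun _ => 0); split; [intros; lia|intros i hi; lia].
  - destruct IH as [f [l [hf hl]]]; [intros; apply hB; lia|].
    destruct (bolzano_weierstrass_R (fun k => s (f k) d) B) as [g [c [hg hc]]].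
    { intros k; apply hB; lia. }
    exists (fun k => f (g k)), (fun i => if Nat.eq_dec i d then c else l i); split.
    + intros k; specialize (hg k); specialize (hf (g k)); lia.
    + intros i hi; destruct (Nat.eq_dec i d) as [->|ne]; [exact hc|].
      apply (Un_cv_comp (fun k => s (f k) i)); [exact hg|apply hl; lia].
Qed.

Ltac wip_expand :=
  repeat rewrite ?wip_sub_l, ?wip_sub_r, ?wip_add_l, ?wip_add_r, ?wip_scal_l, ?wip_scal_r.
Ltac wip_expand_in h :=
  repeat rewrite ?wip_sub_l, ?wip_sub_r, ?wip_add_l, ?wip_add_r, ?wip_scal_l, ?wip_scal_r in h.

(** * Projections *)

Definition ones : nat -> R := fun _ => 1.

Lemma ones_pos i : 0 < ones i.
Proof. unfold ones; lra. Qed.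

Lemma inner_wip d u v : inner d u v = wip d ones u v.
Proof. apply fsum_ext; intros; unfold ones; ring. Qed.

Lemma norm2_wnorm d u : norm2 d u = wnorm d ones u.
Proof. unfold norm2, wnorm; rewrite inner_wip; reflexivity. Qed.

Lemma inv_INR_S_small e : 0 < e -> exists N, forall k, (N <= k)%nat -> / INR (S k) <= e.
Proof.
  intros he; destruct (archimed_cor1 e he) as [N [hN hN0]]; exists N; intros k hk.
  left; apply Rle_lt_trans with (/ INR N); [|exact hN].
  apply Rinv_le_contravar; [apply lt_0_INR; lia|apply le_INR; lia].
Qed.

(** Extracts the first-order part of an inequality along a segment; it serves the variational
    inequality of the projection and the kernel of a semidefinite matrix. The case [t = 1] gives
    [b >= a], so if [a > 0] then [t = a / (2 b)] is admissible and contradicts the hypothesis. *)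
Lemma small_quadratic a b : (forall t, 0 < t <= 1 -> a <= t * b) -> a <= 0.
Proof.
  intros h; apply Rnot_lt_le; intros ha.
  pose proof (h 1 ltac:(lra)).
  assert (ht : 0 < a / (2 * b) <= 1).
  { split; [apply Rdiv_lt_0_compat; lra|].
    apply Rmult_le_reg_r with (2 * b); [lra|]; field_simplify; lra. }
  specialize (h _ ht); replace (a / (2 * b) * b) with (a / 2) in h by (field; lra); lra.
Qed.

Section Projection.
Context (m : nat) (C : vec -> Prop)
  (HCne : nonemptyR C) (HCcl : closedR m C) (HCcv : convexR C).

Lemma convex_comb u v t :
  C u -> C v -> 0 <= t <= 1 -> C (vadd (vscal t u) (vscal (1 - t) v)).
Proof. exact (HCcv u v t). Qed.

(** A minimising sequence is Cauchy by the parallelogram identity, because midpoints stay in [C]. *)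
Lemma proj_exists u : exists p, is_proj m C u p.
Proof.
  set (f := fun c => wip m ones (vsub u c) (vsub u c)).
  assert (fpos : forall c, 0 <= f c) by (intros; apply wip_nonneg, ones_pos).
  (* Suprema are what [completeness] provides, so the squared distances are negated and [- M] is
     their infimum. *)
  destruct (completeness (fun r => exists c, C c /\ r = - f c)) as [M [hub hlub]].
  { exists 0; intros r [c [_ ->]]; specialize (fpos c); lra. }
  { destruct HCne as [c hc]; exists (- f c), c; auto. }
  assert (inf : forall c, C c -> - M <= f c).
  { intros c hc; specialize (hub (- f c) (ex_intro _ c (conj hc eq_refl))); lra. }
  assert (H : forall k, exists c, C c /\ f c <= - M + / INR (S k)).
  { intros k; apply NNPP; intros hn.
    assert (pk : 0 < / INR (S k)) by (apply Rinv_0_lt_compat, lt_0_INR; lia).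
    specialize (hlub (M - / INR (S k))).
    enough (is_upper_bound (fun r => exists c, C c /\ r = - f c) (M - / INR (S k)))
      by (specialize (hlub ltac:(assumption)); lra).
    intros r [c [hc ->]].
    apply Rnot_lt_le; intros hlt; apply hn; exists c; split; [exact hc|lra]. }
  destruct (fun_choice _ H) as [s hs].
  destruct (wnorm_complete (d := m) ones_pos s) as [l hl].
  { intros e he; destruct (inv_INR_S_small (e / 4)) as [N hN]; [lra|].
    exists N; intros j k hj hk.
    (* The squared distance of [s j] and [s k] is [2 f (s j) + 2 f (s k)] minus four times [f] at
       the midpoint, hence at most four excesses over [- M] counted as two pairs, each at most
       [e / 4]. *)
    pose proof (inf _ (convex_comb (s j) (s k) (1 / 2) (proj1 (hs j)) (proj1 (hs k))
                         ltac:(lra))) as hmid.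
    pose proof (proj2 (hs j)) as hsj; pose proof (proj2 (hs k)) as hsk.
    specialize (hN j hj) as hNj; specialize (hN k hk).
    unfold f in hmid, hsj, hsk; wip_expand; wip_expand_in hmid.
    wip_expand_in hsj; wip_expand_in hsk.
    rewrite (wip_sym (s j) u), (wip_sym (s k) u), (wip_sym (s k) (s j)) in *; lra. }
  exists l; split; [apply (HCcl s); [intros; apply hs|exact hl]|].
  intros c hc; change (norm2 m (vsub u l) <= norm2 m (vsub u c)).
  rewrite !norm2_wnorm; apply sqrt_le_1_alt; fold (f l) (f c).
  apply Rle_trans with (- M); [|apply inf, hc].
  assert (h1 : Un_cv (fun k => f (s k)) (f l)).
  { apply wip_cv; (apply vcv_sub; [apply vcv_const|exact hl]). }
  apply Rnot_lt_le; intros hlt.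
  destruct (inv_INR_S_small ((f l + M) / 4)) as [N hN]; [lra|].
  destruct (h1 ((f l + M) / 4)) as [N' hN']; [lra|].
  specialize (hN (N + N')%nat ltac:(lia)); specialize (hN' (N + N')%nat ltac:(lia)).
  pose proof (proj2 (hs (N + N')%nat)); apply Rabs_def2 in hN'; lra.
Qed.

(** Comparing [p] with the point at parameter [t] on the segment towards [c] and dividing by [t]
    bounds the product by a multiple of [t]. *)
Lemma proj_normal u p c :
  is_proj m C u p -> C c -> wip m ones (vsub u p) (vsub c p) <= 0.
Proof.
  intros [hp hmin] hc.
  apply small_quadratic with (wip m ones (vsub c p) (vsub c p)); intros t ht.
  pose proof (hmin _ (convex_comb c p t hc hp ltac:(lra))) as h.
  change (norm2 m (vsub u p) <= norm2 m (vsub u (vadd (vscal t c) (vscal (1 - t) p)))) in h.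
  rewrite !norm2_wnorm in h; apply sqrt_le_0 in h; try apply wip_nonneg, ones_pos.
  pose proof (wip_nonneg (d := m) ones_pos (vsub c p)) as hq.
  apply (Rmult_le_compat_l (t * t)) in hq; [|nra].
  apply Rmult_le_reg_l with t; [lra|].
  wip_expand_in h; wip_expand_in hq; wip_expand.
  rewrite (wip_sym p u), (wip_sym c u), (wip_sym p c) in *; nra.
Qed.

Lemma normal_proj u p :
  C p -> (forall c, C c -> wip m ones (vsub u p) (vsub c p) <= 0) -> is_proj m C u p.
Proof.
  intros hp H; split; [exact hp|]; intros c hc.
  change (norm2 m (vsub u p) <= norm2 m (vsub u c)); rewrite !norm2_wnorm.
  apply sqrt_le_1_alt; specialize (H c hc).
  pose proof (wip_nonneg (d := m) ones_pos (vsub c p)) as h.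
  wip_expand_in h; wip_expand_in H; wip_expand.
  rewrite (wip_sym p u), (wip_sym c u), (wip_sym p c) in *; lra.
Qed.

(** Sum of the two variational inequalities, each tested at the other projection. *)
Lemma proj_firm u v p r :
  is_proj m C u p -> is_proj m C v r ->
  wip m ones (vsub p r) (vsub p r) <= wip m ones (vsub p r) (vsub u v).
Proof.
  intros hp hr.
  pose proof (proj_normal u p r hp (proj1 hr)) as h1.
  pose proof (proj_normal v r p hr (proj1 hp)) as h2.
  wip_expand_in h1; wip_expand_in h2; wip_expand.
  rewrite (wip_sym u p), (wip_sym v p), (wip_sym u r), (wip_sym v r), (wip_sym r p) in *; lra.
Qed.

Lemma proj_nonexpansive u v p r :
  is_proj m C u p -> is_proj m C v r ->
  wnorm m ones (vsub p r) <= wnorm m ones (vsub u v).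
Proof.
  intros hp hr; pose proof (proj_firm u v p r hp hr) as h.
  pose proof (cauchy_schwarz (d := m) ones_pos (vsub p r) (vsub u v)).
  rewrite <- (wnorm_sq ones_pos) in h.
  pose proof (wnorm_nonneg (d := m) (w := ones) (vsub p r)).
  pose proof (wnorm_nonneg (d := m) (w := ones) (vsub u v)).
  apply Rnot_lt_le; intros hlt; nra.
Qed.

End Projection.

(** * Averaged operators *)

Definition increment (s : nat -> vec) (k : nat) : vec := vsub (s (S k)) (s k).

Definition trajectory (T : vec -> vec) (s : nat -> vec) : Prop :=
  forall k, s (S k) = T (s k).

(** This is the usual notion of an [a]-averaged map, with [beta = (1 - a) / a]. *)
Definition averaged (d : nat) (w : nat -> R) (beta : R) (T : vec -> vec) : Prop :=
  forall a b,
    wip d w (vsub (T a) (T b)) (vsub (T a) (T b))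
    + beta * wip d w (vsub (vsub (T a) a) (vsub (T b) b)) (vsub (vsub (T a) a) (vsub (T b) b))
    <= wip d w (vsub a b) (vsub a b).

Lemma vcv_increment_zero d (s : nat -> vec) l :
  vcv d s l -> vcv d (increment s) (fun _ => 0).
Proof.
  intros h i hi; apply Un_cv_limit_ext with (l i - l i); [|ring].
  apply (CV_minus (fun k => s (S k) i) (fun k => s k i)); [|apply h, hi].
  apply (Un_cv_comp (fun k => s k i) (l i) S); [intros; lia|apply h, hi].
Qed.

Lemma vcv_average d (s : nat -> vec) l :
  vcv d (increment s) l -> vcv d (fun k => vscal (/ INR k) (s k)) l.
Proof.
  intros h i hi; apply Un_cv_ext with (fun k => s k i / INR k).
  - intros; unfold vscal, Rdiv; ring.
  - apply (cv_average (fun k => s k i)), (h i hi).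
Qed.

Lemma trajectory_shift T s K : trajectory T s -> trajectory T (fun k => s (K + k)%nat).
Proof. intros h k; rewrite Nat.add_succ_r; apply h. Qed.

Lemma trajectory_iter T a : trajectory T (fun k => Nat.iter k T a).
Proof. intros k; reflexivity. Qed.

Section Averaged.
Context {d : nat} {w : nat -> R} (Hw : forall i, 0 < w i)
  {T : vec -> vec} {beta : R} (Hbeta : 0 < beta) (HT : averaged d w beta T).

Local Notation ip := (wip d w).
Local Notation Q u := (wip d w u u).
Local Notation D := increment.

(** With [E] the difference of the two displacements, expanding the square of [(a - b) + E] leaves
    [2 <E, a - b> + (1 + beta) |E|^2 <= 0]. *)
Lemma averaged_dissipative a b :
  ip (vsub (vsub (T a) a) (vsub (T b) b)) (vsub a b) <= 0.
Proof.
  pose proof (HT a b) as h.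
  pose proof (wip_nonneg (d := d) Hw (vsub (vsub (T a) a) (vsub (T b) b))) as hq.
  set (E := vsub (vsub (T a) a) (vsub (T b) b)) in *.
  rewrite (wip_ext (vsub (T a) (T b)) (vadd (vsub a b) E) (vsub (T a) (T b))
             (vadd (vsub a b) E)) in h by (intros i _; unfold E, vadd, vsub; ring).
  rewrite !wip_add_l, !wip_add_r, (wip_sym (vsub a b) E) in h; nra.
Qed.

Lemma averaged_nonexpansive_sq a b : Q (vsub (T a) (T b)) <= Q (vsub a b).
Proof.
  pose proof (HT a b).
  pose proof (wip_nonneg (d := d) Hw (vsub (vsub (T a) a) (vsub (T b) b))); nra.
Qed.

Lemma averaged_nonexpansive a b : wnorm d w (vsub (T a) (T b)) <= wnorm d w (vsub a b).
Proof. apply sqrt_le_1_alt, averaged_nonexpansive_sq. Qed.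

Lemma increment_decrease s k : trajectory T s ->
  Q (D s (S k)) + beta * Q (vsub (D s (S k)) (D s k)) <= Q (D s k).
Proof.
  intros hs; pose proof (HT (s (S k)) (s k)) as h; rewrite <- !hs in h; exact h.
Qed.

Lemma increment_antitone s k : trajectory T s -> Q (D s k) <= Q (D s O).
Proof.
  intros hs; induction k as [|k IH]; [lra|].
  pose proof (increment_decrease s k hs).
  pose proof (wip_nonneg (d := d) Hw (vsub (D s (S k)) (D s k))); nra.
Qed.

Lemma increment_norm_cv s : trajectory T s ->
  exists r2, 0 <= r2 /\ Un_cv (fun k => Q (D s k)) r2 /\ forall k, r2 <= Q (D s k).
Proof.
  intros hs.
  assert (dec : Un_decreasing (fun k => Q (D s k))).
  { intros k; pose proof (increment_decrease s k hs).
    pose proof (wip_nonneg (d := d) Hw (vsub (D s (S k)) (D s k))); nra. }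
  destruct (decreasing_cv _ dec) as [r2 hr].
  { exists 0; intros r [k ->]; unfold opp_seq.
    pose proof (wip_nonneg (d := d) Hw (D s k)); lra. }
  exists r2; split; [|split; [exact hr|exact (decreasing_ineq _ _ dec hr)]].
  apply (Un_cv_ge _ _ _ hr); intros k; apply wip_nonneg, Hw.
Qed.

(** For one step, [beta] times the squared change of the increment is at most the drop of a
    convergent sequence. This is where averagedness is stronger than nonexpansiveness. *)
Lemma increment_shift_cv s p : trajectory T s ->
  vcv d (fun k => vsub (D s (p + k)) (D s k)) (fun _ => 0).
Proof.
  intros hs.
  assert (h1 : vcv d (fun k => vsub (D s (S k)) (D s k)) (fun _ => 0)).
  { apply (wnorm_vcv Hw).
    destruct (increment_norm_cv s hs) as [r2 [_ [hr _]]].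
    pose proof (CV_minus _ _ _ _ hr (Un_cv_comp _ _ S (fun k => Nat.le_succ_diag_r k) hr))
      as hd.
    rewrite Rminus_diag in hd.
    intros e he; destruct (hd (beta * (e * e))) as [N hN]; [apply Rmult_lt_0_compat; nra|].
    exists N; intros k hk; specialize (hN k hk).
    unfold R_dist in *; rewrite Rminus_0_r in *.
    pose proof (increment_decrease s k hs) as hdec.
    apply Rabs_def2 in hN.
    rewrite (wnorm_ext _ (vsub (D s (S k)) (D s k))) by
      (intros i _; unfold vsub; ring).
    pose proof (wnorm_sq (d := d) Hw (vsub (D s (S k)) (D s k))) as hq.
    pose proof (wnorm_nonneg (d := d) (w := w) (vsub (D s (S k)) (D s k))) as hn.
    rewrite Rabs_pos_eq by exact hn.
    apply Rnot_le_lt; intros hle.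
    assert (e * e <= Q (vsub (D s (S k)) (D s k))) by (rewrite <- hq; nra).
    nra. }
  induction p as [|p IH]; intros i hi.
  - apply Un_cv_ext with (fun _ => 0); [intros; unfold vsub; simpl; ring|apply Un_cv_const].
  - apply Un_cv_ext with (fun k => vsub (D s (S (p + k))) (D s (p + k)) i
                                   + vsub (D s (p + k)) (D s k) i).
    { intros; unfold vsub; simpl; ring. }
    apply Un_cv_limit_ext with (0 + 0); [|ring].
    apply CV_plus; [|exact (IH i hi)].
    apply (Un_cv_comp (fun k => vsub (D s (S k)) (D s k) i) 0 (fun k => (p + k)%nat));
      [intros; lia|exact (h1 i hi)].
Qed.

Lemma displacement_antitone s p k : trajectory T s ->
  wnorm d w (vsub (s (p + k)%nat) (s k)) <= wnorm d w (vsub (s p) (s O)).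
Proof.
  intros hs; induction k as [|k IH]; [rewrite Nat.add_0_r; lra|].
  rewrite Nat.add_succ_r, !hs.
  eapply Rle_trans; [apply averaged_nonexpansive|exact IH].
Qed.

(** The displacement over [p] steps shrinks with the starting time, yet becomes asymptotically [p]
    times a single increment, whose norm is at least [sqrt r2]. *)
Lemma displacement_lower s r2 p : trajectory T s -> 0 <= r2 ->
  (forall k, r2 <= Q (D s k)) -> INR p * INR p * r2 <= Q (vsub (s p) (s O)).
Proof.
  intros hs hr0 hr.
  assert (he : vcv d (fun k => vsub (vsub (s (p + k)%nat) (s k)) (vscal (INR p) (D s k)))
                 (fun _ => 0)).
  { induction p as [|p IH]; intros i hi.
    - apply Un_cv_ext with (fun _ => 0); [intros; unfold vsub, vscal; simpl; ring|].
      apply Un_cv_const.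
    - apply Un_cv_ext with
        (fun k => vsub (vsub (s (p + k)%nat) (s k)) (vscal (INR p) (D s k)) i
                  + vsub (D s (p + k)) (D s k) i).
      { intros k; rewrite S_INR; unfold vsub, vscal, increment, vsub; simpl; ring. }
      apply Un_cv_limit_ext with (0 + 0); [|ring].
      apply CV_plus; [exact (IH i hi)|exact (increment_shift_cv s p hs i hi)]. }
  apply (vcv_wnorm Hw) in he.
  pose proof (sqrt_pos r2) as hsr; pose proof (sqrt_sqrt r2 hr0) as hsq.
  pose proof (pos_INR p) as hp.
  rewrite <- (wnorm_sq Hw).
  replace (INR p * INR p * r2) with ((INR p * sqrt r2) * (INR p * sqrt r2)) by
    (transitivity (INR p * INR p * (sqrt r2 * sqrt r2)); [ring|rewrite hsq; ring]).
  assert (0 <= INR p * sqrt r2) by (apply Rmult_le_pos; assumption).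
  enough (INR p * sqrt r2 <= wnorm d w (vsub (s p) (s O))) by
    (apply Rmult_le_compat; assumption).
  apply Rnot_lt_le; intros hlt.
  destruct (he (INR p * sqrt r2 - wnorm d w (vsub (s p) (s O)))) as [N hN]; [lra|].
  specialize (hN N (Nat.le_refl N)); unfold R_dist in hN.
  rewrite Rminus_0_r, Rabs_pos_eq in hN by apply wnorm_nonneg.
  rewrite (wnorm_ext _ (vsub (vsub (s (p + N)%nat) (s N)) (vscal (INR p) (D s N)))) in hN
    by (intros i _; unfold vsub; ring).
  pose proof (displacement_antitone s p N hs).
  pose proof (wnorm_sub_le (d := d) Hw (vscal (INR p) (D s N)) (vsub (s (p + N)%nat) (s N)))
    as ht.
  rewrite wnorm_scal, (wnorm_sub_sym (vscal _ _)), Rabs_pos_eq in ht by assumption.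
  assert (sqrt r2 <= wnorm d w (D s N)) by apply sqrt_le_1_alt, hr.
  nra.
Qed.

Lemma displacement_upper s p : trajectory T s ->
  wnorm d w (vsub (s p) (s O)) <= INR p * wnorm d w (D s O).
Proof.
  intros hs; induction p as [|p IH].
  - simpl; rewrite Rmult_0_l; apply wnorm_le; [lra|].
    rewrite wip_sub_l, wip_sub_r; lra.
  - pose proof (wnorm_triangle (d := d) Hw (s (S p)) (s p) (s O)) as ht.
    assert (wnorm d w (D s p) <= wnorm d w (D s O)) by
      apply sqrt_le_1_alt, increment_antitone, hs.
    rewrite S_INR; unfold increment at 1 in H; lra.
Qed.

(* Otherwise the squared displacement, which telescopes into the products below,
   would eventually stay under its lower bound [p ^ 2 * r2]. *)
Lemma aligned_increments s r2 e M : trajectory T s -> 0 <= r2 ->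
  (forall k, r2 <= Q (D s k)) -> 0 < e ->
  exists p, (M <= p)%nat /\ (r2 - e) * INR p <= ip (D s p) (vsub (s p) (s O)).
Proof.
  intros hs hr0 hr he; apply NNPP; intros hn.
  assert (hlt : forall p, (M <= p)%nat ->
            ip (D s p) (vsub (s p) (s O)) < (r2 - e) * INR p).
  { intros p hp; apply Rnot_le_lt; intros hle; apply hn; exists p; auto. }
  set (B := Q (D s O)); set (a := fun p => Q (vsub (s p) (s O))).
  (* Each step adds less than [2 (r2 - e) p + B], while [(p + 1)^2 - p^2 = 2 p + 1]. The mismatch
     [e - r2] is at most [e], whence the linear coefficient [B + e]. *)
  assert (hgrow : forall j, a (M + j)%nat <= a M +
      (r2 - e) * (INR (M + j) * INR (M + j) - INR M * INR M) + (B + e) * INR j).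
  { induction j as [|j IH]; [rewrite Nat.add_0_r; simpl; lra|].
    specialize (hlt (M + j)%nat ltac:(lia)).
    pose proof (increment_antitone s (M + j) hs) as hB; fold B in hB.
    assert (hstep : a (M + S j)%nat = a (M + j)%nat
              + 2 * ip (D s (M + j)) (vsub (s (M + j)%nat) (s O)) + Q (D s (M + j))).
    { unfold a; rewrite Nat.add_succ_r.
      rewrite (wip_ext (vsub (s (S (M + j))) (s O))
                (vadd (D s (M + j)) (vsub (s (M + j)%nat) (s O)))
                (vsub (s (S (M + j))) (s O))
                (vadd (D s (M + j)) (vsub (s (M + j)%nat) (s O))))
        by (intros i _; unfold increment, vadd, vsub; ring).
      rewrite !wip_add_l, !wip_add_r, (wip_sym (vsub _ _) (D _ _)); ring. }
    rewrite hstep, Nat.add_succ_r, !S_INR; nra. }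
  destruct (INR_unbounded ((Rabs (a M) + Rabs ((r2 - e) * (INR M * INR M)) + B + e) / e + 1))
    as [j hj].
  specialize (hgrow j).
  pose proof (displacement_lower s r2 (M + j) hs hr0 hr) as hlow; fold (a (M + j)%nat) in hlow.
  assert (hB : 0 <= B) by apply wip_nonneg, Hw.
  pose proof (Rle_abs (a M)); pose proof (Rle_abs (- ((r2 - e) * (INR M * INR M)))) as h2.
  rewrite Rabs_Ropp in h2; rewrite plus_INR in *.
  pose proof (pos_INR M).
  set (c := Rabs (a M) + Rabs ((r2 - e) * (INR M * INR M))) in *.
  assert (hc : 0 <= c) by (unfold c; pose proof (Rabs_pos (a M));
    pose proof (Rabs_pos ((r2 - e) * (INR M * INR M))); lra).
  assert (h3 : c + B + e <= e * (INR j - 1)).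
  { apply Rmult_le_reg_r with (/ e); [apply Rinv_0_lt_compat, he|].
    replace (e * (INR j - 1) * / e) with (INR j - 1) by (field; lra).
    unfold Rdiv in hj; lra. }
  assert (1 <= INR j).
  { assert (0 <= (c + B + e) / e) by (apply Rle_mult_inv_pos; lra). lra. }
  assert (h4 : (c + B + e) * INR j <= e * (INR j - 1) * INR j)
    by (apply Rmult_le_compat_r; lra).
  assert (c <= c * INR j) by nra.
  assert (e * (INR j * INR j) <= e * ((INR M + INR j) * (INR M + INR j)))
    by (apply Rmult_le_compat_l; nra).
  unfold c in *; nra.
Qed.

(** Let [v] be the mean displacement up to a large aligned time [p]. Dissipativity between [s p] and
    [s l] gives [<D s l, v> >= r2 - 2 e] for each [l <= i + j], and both squared norms are at most
    [B], so [D s l] is within [2 (B - r2) + 4 e] of [v] in squared norm. The parallelogram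
    inequality then compares [D s i] with [D s j]. *)
Lemma increments_close s r2 i j : trajectory T s -> 0 <= r2 ->
  (forall k, r2 <= Q (D s k)) ->
  Q (vsub (D s i) (D s j)) <= 8 * (Q (D s O) - r2).
Proof.
  intros hs hr0 hr.
  set (B := Q (D s O)); assert (hB : 0 <= B) by apply wip_nonneg, Hw.
  apply Rnot_lt_le; intros hlt.
  (* The argument loses [16 e], which is half of the excess to be refuted. *)
  set (e := (Q (vsub (D s i) (D s j)) - 8 * (B - r2)) / 32).
  assert (he : 0 < e) by (unfold e; lra).
  (* Replacing [s l] by [s O] in the dissipativity inequality costs two terms of size at most [B l];
     beyond this [M] they are absorbed by [e p]. *)
  destruct (INR_unbounded (2 * B * INR (i + j) / e)) as [M hM].
  destruct (aligned_increments s r2 e (S M + i + j) hs hr0 hr he) as [p [hp hal]].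
  assert (hpM : INR M < INR p) by (apply lt_INR; lia).
  assert (p0 : 0 < INR p) by (apply lt_0_INR; lia).
  assert (hbig : 2 * B * INR (i + j) <= e * INR p).
  { apply Rmult_le_reg_r with (/ e); [apply Rinv_0_lt_compat, he|].
    replace (e * INR p * / e) with (INR p) by (field; lra).
    unfold Rdiv in hM; lra. }
  set (v := vscal (/ INR p) (vsub (s p) (s O))).
  assert (hv : Q v <= B).
  { unfold v; rewrite <- (wnorm_sq Hw), wnorm_scal.
    rewrite Rabs_pos_eq by (left; apply Rinv_0_lt_compat, p0).
    pose proof (displacement_upper s p hs) as hu.
    assert (hu' : / INR p * wnorm d w (vsub (s p) (s O)) <= wnorm d w (D s O)).
    { apply Rmult_le_reg_l with (INR p); [exact p0|].
      rewrite <- Rmult_assoc, Rinv_r, Rmult_1_l by lra; exact hu. }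
    unfold B; rewrite <- (wnorm_sq Hw).
    assert (0 <= / INR p * wnorm d w (vsub (s p) (s O)))
      by (apply Rmult_le_pos; [left; apply Rinv_0_lt_compat, p0|apply wnorm_nonneg]).
    nra. }
  assert (hclose : forall l, (l <= i + j)%nat -> Q (vsub (D s l) v) <= 2 * (B - r2) + 4 * e).
  { intros l hl.
    pose proof (averaged_dissipative (s p) (s l)) as hd; rewrite <- !hs in hd.
    fold (D s p) (D s l) in hd.
    pose proof (displacement_upper s l hs) as hul.
    pose proof (increment_antitone s l hs) as hDl; fold B in hDl.
    pose proof (increment_antitone s p hs) as hDp; fold B in hDp.
    set (b := sqrt B); assert (hb : 0 <= b) by apply sqrt_pos.
    assert (hbb : b * b = B) by apply sqrt_sqrt, hB.
    assert (hQl : Q (vsub (s l) (s O)) <= (INR l * b) * (INR l * b)).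
    { rewrite <- (wnorm_sq Hw); pose proof (wnorm_nonneg (d := d) (w := w) (vsub (s l) (s O))).
      change (wnorm d w (D s O)) with b in hul; nra. }
    assert (hlpos : 0 <= INR l * b) by (apply Rmult_le_pos; [apply pos_INR|exact hb]).
    pose proof (wip_le_norms (d := d) Hw (D s p) (vsub (s l) (s O)) b _ hb hlpos
                  ltac:(lra) hQl) as c1.
    pose proof (wip_le_norms (d := d) Hw (vscal (-1) (D s l)) (vsub (s l) (s O)) b _ hb hlpos
                  ltac:(wip_expand; lra) hQl) as c2.
    rewrite wip_scal_l in c2.
    assert (hll : B * INR l <= B * INR (i + j))
      by (apply Rmult_le_compat_l; [exact hB|apply le_INR, hl]).
    assert (hal' : (r2 - 2 * e) * INR p <= ip (D s l) (vsub (s p) (s O))).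
    { rewrite wip_sub_l, !(wip_sub_r _ (s l)) in hd.
      replace (b * (INR l * b)) with (B * INR l) in * by (rewrite <- hbb; ring).
      rewrite !wip_sub_r in *; lra. }
    assert (hlv : r2 - 2 * e <= ip (D s l) v).
    { unfold v; rewrite wip_scal_r; apply Rmult_le_reg_r with (INR p); [exact p0|].
      replace (/ INR p * ip (D s l) (vsub (s p) (s O)) * INR p)
        with (ip (D s l) (vsub (s p) (s O))) by (field; lra); exact hal'. }
    rewrite wip_sub_l, !wip_sub_r, (wip_sym v (D s l)); lra. }
  pose proof (hclose i ltac:(lia)) as hi; pose proof (hclose j ltac:(lia)) as hj.
  pose proof (wip_nonneg (d := d) Hw (vsub (vadd (D s i) (D s j)) (vscal 2 v))) as hpar.
  wip_expand_in hpar; wip_expand_in hi; wip_expand_in hj.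
  assert (he' : 32 * e = Q (vsub (D s i) (D s j)) - 8 * (B - r2)) by (unfold e; field).
  wip_expand_in he'.
  rewrite (wip_sym v (D s i)), (wip_sym v (D s j)), (wip_sym (D s j) (D s i)) in *; lra.
Qed.

(** Restarting the trajectory at [N] puts the excess of the [N]-th squared increment over [r2] in
    the previous bound, and this excess tends to 0: the increments are Cauchy. *)
Lemma increment_cv s : trajectory T s -> exists l, vcv d (D s) l.
Proof.
  intros hs; destruct (increment_norm_cv s hs) as [r2 [hr0 [hcv hr]]].
  apply (wnorm_complete Hw); intros e he.
  destruct (hcv (e / 8)) as [N hN]; [lra|].
  exists N; intros j k hj hk; specialize (hN N (Nat.le_refl N)); apply Rabs_def2 in hN.
  pose proof (increments_close (fun k => s (N + k)%nat) r2 (j - N) (k - N)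
     (trajectory_shift T s N hs) hr0) as h.
  unfold increment in *; rewrite !Nat.add_succ_r, Nat.add_0_r in h.
  replace (N + (j - N))%nat with j in h by lia; replace (N + (k - N))%nat with k in h by lia.
  enough (Q (vsub (vsub (s (S j)) (s j)) (vsub (s (S k)) (s k))) <=
            8 * (Q (vsub (s (S N)) (s N)) - r2)) by lra.
  apply h; intros l; rewrite Nat.add_succ_r; apply hr.
Qed.

(** The squared distance of two trajectories decreases and converges, and averagedness bounds [beta]
    times the squared difference of their increments by its drops. *)
Lemma increment_limit_unique s t l l' : trajectory T s -> trajectory T t ->
  vcv d (D s) l -> vcv d (D t) l' -> veq d l l'.
Proof.
  intros hs ht hl hl'.
  assert (dec : Un_decreasing (fun k => Q (vsub (s k) (t k)))).
  { intros k; rewrite hs, ht; apply averaged_nonexpansive_sq. }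
  destruct (decreasing_cv _ dec) as [c hc].
  { exists 0; intros r [k ->]; unfold opp_seq.
    pose proof (wip_nonneg (d := d) Hw (vsub (s k) (t k))); lra. }
  pose proof (CV_minus _ _ _ _ hc (Un_cv_comp _ _ S (fun k => Nat.le_succ_diag_r k) hc)) as hd.
  rewrite Rminus_diag in hd.
  pose proof (vcv_sub _ _ _ _ hl hl') as hdd.
  pose proof (Un_cv_scal beta _ _ (wip_cv (w := w) _ _ _ _ hdd hdd)) as hq.
  assert (hz : beta * Q (vsub l l') <= 0).
  { apply (fun H => Rle_cv_lim H hq hd); intros k.
    pose proof (HT (s k) (t k)) as h; rewrite <- hs, <- ht in h.
    unfold increment; lra. }
  intros i hi; pose proof (wip_zero (d := d) Hw (vsub l l') ltac:(nra) i hi) as hi0.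
  unfold vsub in hi0; lra.
Qed.

Lemma increment_limit_min s l : trajectory T s -> vcv d (D s) l ->
  Q l <= ip (D s O) l.
Proof.
  intros hs hl.
  assert (hx : vcv d (fun k => vscal (/ INR k) (vsub (s k) (s O))) l).
  { intros i hi; apply Un_cv_ext with (fun k => vsub (s k) (s O) i / INR k).
    { intros; unfold vscal, Rdiv; ring. }
    apply (cv_average (fun k => vsub (s k) (s O) i)).
    apply Un_cv_ext with (fun k => D s k i); [|exact (hl i hi)].
    intros; unfold increment, vsub; ring. }
  pose proof (vcv_sub _ _ _ _ (vcv_const (d := d) (D s O)) hl) as hd.
  pose proof (wip_cv (w := w) _ _ _ _ hd hx) as h.
  enough (0 <= ip (vsub (D s O) l) l) by (rewrite wip_sub_l in *; lra).
  apply (Un_cv_ge _ _ _ h); intros k.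
  pose proof (averaged_dissipative (s k) (s O)) as hdis; rewrite <- !hs in hdis.
  fold (D s k) (D s O) in hdis; rewrite wip_scal_r, wip_sub_l in *.
  apply Rmult_le_pos; [|lra].
  (* At [k = 0] the convention that the inverse of 0 is 0 makes the factor vanish. *)
  destruct k as [|k]; [simpl; rewrite Rinv_0; lra|].
  left; apply Rinv_0_lt_compat, lt_0_INR; lia.
Qed.

Lemma minimal_displacement :
  exists l, (forall s, trajectory T s -> vcv d (D s) l) /\
            (forall a, Q l <= ip (vsub (T a) a) l).
Proof.
  destruct (increment_cv _ (trajectory_iter T (fun _ => 0))) as [l hl]; exists l.
  assert (H : forall s, trajectory T s -> vcv d (D s) l).
  { intros s hs; destruct (increment_cv s hs) as [l' hl'].
    intros i hi; rewrite (increment_limit_unique _ _ _ _ (trajectory_iter T _) hs hl hl' i hi).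
    exact (hl' i hi). }
  split; [exact H|]; intros a.
  apply (increment_limit_min _ l (trajectory_iter T a)), H, trajectory_iter.
Qed.

End Averaged.

(** * Inexact iterations *)

(** The Cauchy form of summability: the shadowing bounds involve only finite tails, and neither
    shifts nor combinations require tracking the value of the series. *)
Definition small_tails (e : nat -> R) : Prop :=
  forall eps, 0 < eps -> exists N0, forall N j, (N0 <= N)%nat ->
    fsum j (fun i => e (N + i)%nat) <= eps.

Lemma summable_small_tails (e : nat -> R) l : infinite_sum e l -> small_tails e.
Proof.
  intros he eps heps; destruct (he (eps / 2)) as [N hN]; [lra|].
  (* [sum_f_R0] includes its last index, so a tail is a difference of partial sums only when it
     starts at a successor. *)
  exists (S N); intros [|K] j hK; [lia|].
  assert (tel : fsum j (fun i => e (S K + i)%nat) = sum_f_R0 e (K + j) - sum_f_R0 e K).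
  { induction j as [|j IH]; [rewrite Nat.add_0_r; simpl; ring|].
    rewrite Nat.add_succ_r; cbn [fsum sum_f_R0]; rewrite IH; simpl; ring. }
  rewrite tel.
  pose proof (hN K ltac:(lia)) as h1; pose proof (hN (K + j)%nat ltac:(lia)) as h2.
  apply Rabs_def2 in h1; apply Rabs_def2 in h2; lra.
Qed.

Lemma small_tails_cv e : (forall k, 0 <= e k) -> small_tails e -> Un_cv e 0.
Proof.
  intros hpos h eps heps; destruct (h (eps / 2)) as [N hN]; [lra|].
  exists N; intros k hk; specialize (hN k 1%nat hk); simpl in hN; rewrite Nat.add_0_r in hN.
  unfold R_dist; rewrite Rminus_0_r, Rabs_pos_eq by apply hpos; lra.
Qed.

Lemma small_tails_shift e : small_tails e -> small_tails (fun k => e (S k)).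
Proof.
  intros h eps heps; destruct (h eps heps) as [N0 hN]; exists N0; intros N j hN0.
  exact (hN (S N) j ltac:(lia)).
Qed.

Lemma small_tails_lin a b e f : 0 <= a -> 0 <= b -> small_tails e -> small_tails f ->
  small_tails (fun k => a * e k + b * f k).
Proof.
  intros ha hb he hf eps heps.
  assert (hc : 0 < eps / (a + b + 1)) by (apply Rdiv_lt_0_compat; lra).
  destruct (he _ hc) as [N1 h1]; destruct (hf _ hc) as [N2 h2].
  exists (N1 + N2)%nat; intros N j hN; rewrite fsum_lin.
  specialize (h1 N j ltac:(lia)); specialize (h2 N j ltac:(lia)).
  apply Rle_trans with ((a + b + 1) * (eps / (a + b + 1))); [|right; field; lra].
  apply (Rmult_le_compat_l a) in h1; [|exact ha].
  apply (Rmult_le_compat_l b) in h2; [|exact hb]; lra.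
Qed.

Section Inexact.
Context {d : nat} {w : nat -> R} (Hw : forall i, 0 < w i)
  {T : vec -> vec} {beta : R} (Hbeta : 0 < beta) (HT : averaged d w beta T)
  (s : nat -> vec) (e : nat -> R) (Hsum : small_tails e)
  (Hs : forall k, wnorm d w (vsub (s (S k)) (T (s k))) <= e k).

(** Nonexpansiveness carries old errors along without amplifying them. The recursion for [t] is
    required only on the first [d] coordinates, so that a constant sequence at a fixed point
    qualifies; this case is quasi-Fejer monotonicity. *)
Lemma inexact_shadow t N j : (forall k, veq d (t (S k)) (T (t k))) ->
  wnorm d w (vsub (s (N + j)%nat) (t j))
  <= wnorm d w (vsub (s N) (t O)) + fsum j (fun i => e (N + i)%nat).
Proof.
  intros ht; induction j as [|j IH]; [rewrite Nat.add_0_r; simpl; lra|].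
  rewrite Nat.add_succ_r; cbn [fsum].
  rewrite (wnorm_ext (vsub (s (S (N + j))) (t (S j))) (vsub (s (S (N + j))) (T (t j)))) by
    (intros i hi; unfold vsub; rewrite (ht j i hi); ring).
  pose proof (wnorm_triangle (d := d) Hw (s (S (N + j))) (T (s (N + j)%nat)) (T (t j))).
  pose proof (averaged_nonexpansive Hw Hbeta HT (s (N + j)%nat) (t j)).
  pose proof (Hs (N + j)%nat); lra.
Qed.

(** From a late [N] on, the exact trajectory through [s N] keeps [g] within [eps / 4] of its value
    on the iterates, so increments differ by at most [eps / 2]. A general Lipschitz [g] covers the
    coordinates of the state and those of its projection. *)
Lemma inexact_increment (g : vec -> R) L gamma :
  (forall a b, Rabs (g a - g b) <= L * wnorm d w (vsub a b)) ->
  (forall t, trajectory T t -> Un_cv (fun k => g (t (S k)) - g (t k)) gamma) ->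
  Un_cv (fun k => g (s (S k)) - g (s k)) gamma.
Proof.
  intros hL hg eps heps.
  assert (hc : 0 < eps / (4 * (Rabs L + 1))).
  { apply Rdiv_lt_0_compat; [lra|]; pose proof (Rabs_pos L); lra. }
  destruct (Hsum _ hc) as [N hN].
  set (t := fun k => Nat.iter k T (s N)).
  assert (ht : forall j, Rabs (g (s (N + j)%nat) - g (t j)) <= eps / 4).
  { intros j; eapply Rle_trans; [apply hL|].
    pose proof (inexact_shadow t N j (fun k i _ => eq_refl)) as h.
    pose proof (hN N j (Nat.le_refl N)) as h2.
    assert (h0 : wnorm d w (vsub (s N) (t O)) <= 0).
    { apply wnorm_le; [lra|]; unfold t; simpl; rewrite wip_sub_l, wip_sub_r; lra. }
    pose proof (wnorm_nonneg (d := d) (w := w) (vsub (s (N + j)%nat) (t j))).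
    pose proof (Rle_abs L); pose proof (Rabs_pos L).
    apply Rle_trans with ((Rabs L + 1) * (eps / (4 * (Rabs L + 1)))).
    - apply Rle_trans with ((Rabs L + 1) * wnorm d w (vsub (s (N + j)%nat) (t j))).
      + apply Rmult_le_compat_r; lra.
      + apply Rmult_le_compat_l; lra.
    - right; field; lra. }
  destruct (hg t (trajectory_iter T (s N)) (eps / 2)) as [K hK]; [lra|].
  exists (N + K)%nat; intros k hk.
  specialize (hK (k - N)%nat ltac:(lia)); apply Rabs_def2 in hK.
  pose proof (ht (k - N)%nat) as h1; pose proof (ht (S (k - N))) as h2.
  rewrite Nat.add_succ_r in h2; replace (N + (k - N))%nat with k in * by lia.
  unfold R_dist; apply Rabs_def1; unfold Rabs in h1, h2;
    destruct (Rcase_abs (g (s k) - g (t (k - N)%nat)));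
    destruct (Rcase_abs (g (s (S k)) - g (t (S (k - N))))); lra.
Qed.

Lemma inexact_increment_cv l :
  (forall t, trajectory T t -> vcv d (increment t) l) -> vcv d (increment s) l.
Proof.
  intros H i hi; apply (inexact_increment (fun a => a i) (/ sqrt (w i))).
  - intros a b; apply (coord_le_wnorm Hw (vsub a b) i hi).
  - intros t ht; exact (H t ht i hi).
Qed.

(** The bound around [f] gives a cluster point [l]; vanishing increments make [l] fixed; the same
    bound around [l] then forces the whole sequence to converge to it. *)
Lemma inexact_converges f : veq d (T f) f ->
  exists l, vcv d s l /\ veq d (T l) l.
Proof.
  intros hf.
  destruct (minimal_displacement Hw Hbeta HT) as [dl [hdl hmin]].
  (* The minimality inequality at the fixed point [f] reads [|dl|^2 <= <T f - f, dl> = 0]. *)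
  assert (hdl0 : veq d dl (fun _ => 0)).
  { apply (wip_zero Hw); eapply Rle_trans; [apply (hmin f)|].
    rewrite wip_sym, wip_zero_r; [lra|].
    intros i hi; unfold vsub; rewrite (hf i hi); ring. }
  assert (hfix : forall a, veq d (T a) a -> forall N j,
            wnorm d w (vsub (s (N + j)%nat) a)
            <= wnorm d w (vsub (s N) a) + fsum j (fun i => e (N + i)%nat)).
  { intros a ha N j; apply (inexact_shadow (fun _ => a)).
    intros _ i hi; rewrite ha by exact hi; reflexivity. }
  destruct (Hsum 1 Rlt_0_1) as [N0 hN0].
  assert (hbd : exists B, forall k i, (i < d)%nat -> Rabs (s (N0 + k)%nat i) <= B).
  (* A single constant for the finitely many coordinates: it bounds the fixed point and the passage
     from the weighted norm to coordinates. *)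
  { assert (hc : exists c, forall i, (i < d)%nat -> Rabs (f i) <= c /\ / sqrt (w i) <= c).
    { clear; induction d as [|n [c hc]]; [exists 0; intros; lia|].
      exists (Rabs (f n) + / sqrt (w n) + Rabs c); intros i hi.
      pose proof (Rabs_pos (f n)); pose proof (Rabs_pos c); pose proof (Rle_abs c).
      assert (0 <= / sqrt (w n)) by
        (destruct (Req_dec (sqrt (w n)) 0) as [->|ne]; [rewrite Rinv_0; lra|];
         left; apply Rinv_0_lt_compat; pose proof (sqrt_pos (w n)); lra).
      destruct (Nat.eq_dec i n) as [->|ne]; [lra|].
      destruct (hc i ltac:(lia)); lra. }
    destruct hc as [c hc].
    set (b := wnorm d w (vsub (s N0) f) + 1).
    exists (c + Rabs c * b); intros k i hi; destruct (hc i hi) as [hc1 hc2].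
    pose proof (coord_le_wnorm Hw (vsub (s (N0 + k)%nat) f) i hi) as h1.
    pose proof (hfix f hf N0 k) as h2; pose proof (hN0 N0 k (Nat.le_refl _)) as h3.
    assert (hv : Rabs (vsub (s (N0 + k)%nat) f i) <= Rabs c * b).
    { eapply Rle_trans; [exact h1|].
      apply Rmult_le_compat.
      - left; apply Rinv_0_lt_compat, sqrt_lt_R0, Hw.
      - apply wnorm_nonneg.
      - pose proof (Rle_abs c); lra.
      - unfold b; lra. }
    replace (s (N0 + k)%nat i) with (f i + vsub (s (N0 + k)%nat) f i)
      by (unfold vsub; ring).
    eapply Rle_trans; [apply Rabs_triang|lra]. }
  destruct hbd as [B hB].
  destruct (bolzano_weierstrass d (fun k => s (N0 + k)%nat) B hB) as [phi [l [hphi hl]]].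
  pose proof (vcv_wnorm Hw _ _ hl) as hln.
  assert (hinc : Un_cv (fun k => wnorm d w (increment s (N0 + phi k)%nat)) 0).
  { pose proof (vcv_wnorm Hw _ _ (inexact_increment_cv dl hdl)) as h.
    apply Un_cv_ext with (fun k => wnorm d w (vsub (increment s (N0 + phi k)%nat) dl)).
    - intros k; apply wnorm_ext; intros i hi; unfold vsub; rewrite (hdl0 i hi); ring.
    - apply (Un_cv_comp _ _ (fun k => (N0 + phi k)%nat)) in h; [exact h|].
      intros k; specialize (hphi k); lia. }
  assert (hTl : veq d (T l) l).
  (* Going from [T l] to [l] through [T (s j)], [s (S j)] and [s j] takes four legs, each at most a
     quarter of [eta] and three of them strictly less. *)
  { assert (hz : wnorm d w (vsub (T l) l) <= 0).
    { apply Rnot_lt_le; intros hlt; set (eta := wnorm d w (vsub (T l) l)) in *.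
      destruct (hln (eta / 4)) as [K1 hK1]; [lra|].
      destruct (hinc (eta / 4)) as [K2 hK2]; [lra|].
      destruct (Hsum (eta / 4)) as [K3 hK3]; [lra|].
      set (k := (K1 + K2 + K3)%nat); set (j := (N0 + phi k)%nat).
      specialize (hK1 k ltac:(unfold k; lia)); specialize (hK2 k ltac:(unfold k; lia)).
      specialize (hK3 j 1%nat ltac:(unfold j, k; specialize (hphi k); unfold k in hphi; lia)).
      unfold R_dist in hK1, hK2; rewrite Rminus_0_r, Rabs_pos_eq in hK1, hK2
        by apply wnorm_nonneg.
      fold j in hK1, hK2; simpl in hK3; rewrite Nat.add_0_r in hK3.
      pose proof (wnorm_triangle (d := d) Hw (T l) (T (s j)) l) as t1.
      pose proof (wnorm_triangle (d := d) Hw (T (s j)) (s (S j)) l) as t2.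
      pose proof (wnorm_triangle (d := d) Hw (s (S j)) (s j) l) as t3.
      pose proof (averaged_nonexpansive Hw Hbeta HT l (s j)) as t4.
      rewrite (wnorm_sub_sym l) in t4; rewrite (wnorm_sub_sym (T (s j)) (s (S j))) in t2.
      pose proof (Hs j); fold (increment s j) in t3; fold eta in t1; lra. }
    assert (h0 : veq d (vsub (T l) l) (fun _ => 0)).
    { apply (wip_zero Hw); rewrite <- (wnorm_sq Hw).
      pose proof (wnorm_nonneg (d := d) (w := w) (vsub (T l) l)); nra. }
    intros i hi; specialize (h0 i hi); unfold vsub in h0; lra. }
  exists l; split; [|exact hTl].
  apply (wnorm_vcv Hw); intros eps heps.
  destruct (Hsum (eps / 3)) as [K1 hK1]; [lra|].
  destruct (hln (eps / 3)) as [K2 hK2]; [lra|].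
  set (j := (N0 + phi (K1 + K2))%nat).
  specialize (hK2 (K1 + K2)%nat ltac:(lia)); fold j in hK2.
  exists j; intros k hk.
  specialize (hK1 j (k - j)%nat ltac:(unfold j; specialize (hphi (K1 + K2)%nat); lia)).
  pose proof (hfix l hTl j (k - j)%nat) as h.
  replace (j + (k - j))%nat with k in h by lia.
  unfold R_dist in *; rewrite Rminus_0_r in *.
  rewrite Rabs_pos_eq in * by apply wnorm_nonneg; lra.
Qed.

End Inexact.

(** * Matrices and positive definite systems *)

Lemma mv_ext r c A u v : veq c u v -> mv r c A u = mv r c A v.
Proof.
  intros h; apply functional_extensionality; intros i; apply fsum_ext; intros j hj.
  rewrite h by exact hj; reflexivity.
Qed.

Lemma mtv_ext r c A u v : veq r u v -> mtv r c A u = mtv r c A v.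
Proof.
  intros h; apply functional_extensionality; intros j; apply fsum_ext; intros i hi.
  rewrite h by exact hi; reflexivity.
Qed.

Lemma mv_lin r c A a b u v :
  mv r c A (vadd (vscal a u) (vscal b v)) = vadd (vscal a (mv r c A u)) (vscal b (mv r c A v)).
Proof.
  apply functional_extensionality; intros i; unfold mv, vadd, vscal.
  rewrite <- fsum_lin; apply fsum_ext; intros; ring.
Qed.

Lemma mtv_lin r c A a b u v :
  mtv r c A (vadd (vscal a u) (vscal b v))
  = vadd (vscal a (mtv r c A u)) (vscal b (mtv r c A v)).
Proof.
  apply functional_extensionality; intros i; unfold mtv, vadd, vscal.
  rewrite <- fsum_lin; apply fsum_ext; intros; ring.
Qed.

Lemma vsub_lin u v : vsub u v = vadd (vscal 1 u) (vscal (-1) v).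
Proof. apply functional_extensionality; intros i; unfold vsub, vadd, vscal; ring. Qed.

Lemma mv_sub r c A u v : mv r c A (vsub u v) = vsub (mv r c A u) (mv r c A v).
Proof. rewrite !vsub_lin; apply mv_lin. Qed.

Lemma mtv_sub r c A u v : mtv r c A (vsub u v) = vsub (mtv r c A u) (mtv r c A v).
Proof. rewrite !vsub_lin; apply mtv_lin. Qed.

Lemma mv_adjoint r c A x y :
  wip r ones (mv r c A x) y = wip c ones x (mtv r c A y).
Proof.
  unfold wip, mv, mtv, ones.
  transitivity (fsum r (fun i => fsum c (fun j => A i j * x j * y i))).
  - apply fsum_ext; intros i hi; rewrite Rmult_1_l, Rmult_comm, <- fsum_scal.
    apply fsum_ext; intros; ring.
  - rewrite fsum_swap; apply fsum_ext; intros j hj.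
    rewrite Rmult_1_l, <- fsum_scal; apply fsum_ext; intros; ring.
Qed.

Lemma psd_kernel_orthogonal n P x u :
  psd n P -> veq n (mv n n P x) (fun _ => 0) -> wip n ones x (mv n n P u) = 0.
Proof.
  intros [hsym _] hx; rewrite wip_sym, mv_adjoint; apply wip_zero_r.
  intros i hi; rewrite <- (hx i hi); apply fsum_ext; intros j hj.
  rewrite (hsym j i hj hi); reflexivity.
Qed.

Lemma mv_cv r c A s l : vcv c s l -> vcv r (fun k => mv r c A (s k)) (mv r c A l).
Proof.
  intros h i hi; apply (fsum_cv c (fun k j => A i j * s k j)).
  intros j hj; apply Un_cv_scal, h, hj.
Qed.

Lemma mtv_cv r c A s l : vcv r s l -> vcv c (fun k => mtv r c A (s k)) (mtv r c A l).
Proof.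
  intros h j hj; apply (fsum_cv r (fun k i => A i j * s k i)).
  intros i hi; apply Un_cv_scal, h, hi.
Qed.

(* The range of a coercive linear map is closed, and the residual of the projection
   of [b] onto it is orthogonal to its own image, hence zero. *)
Lemma coercive_surjective d (L : vec -> vec) c :
  0 < c ->
  (forall a b u v, veq d (L (vadd (vscal a u) (vscal b v)))
                         (vadd (vscal a (L u)) (vscal b (L v)))) ->
  (forall s l, vcv d s l -> vcv d (fun k => L (s k)) (L l)) ->
  (forall x, c * wip d ones x x <= wip d ones x (L x)) ->
  forall b, exists x, veq d (L x) b.
Proof.
  intros hc hlin hcont hcoer b.
  assert (hsub : forall u v, veq d (L (vsub u v)) (vsub (L u) (L v))).
  { intros u v; rewrite !vsub_lin; apply hlin. }
  (* Expanding the square of [L x - c x] turns coercivity into a lower bound on [L], which makes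
     preimages of a convergent sequence Cauchy. *)
  assert (hinj : forall x, c * c * wip d ones x x <= wip d ones (L x) (L x)).
  { intros x; specialize (hcoer x).
    pose proof (wip_nonneg (d := d) ones_pos (vsub (L x) (vscal c x))) as h.
    wip_expand_in h; rewrite (wip_sym (L x) x) in h; nra. }
  set (K := fun y => exists x, veq d (L x) y).
  assert (Kne : nonemptyR K) by (exists (L b), b; intros i hi; reflexivity).
  assert (Kcv : convexR K).
  { intros u v t [xu hu] [xv hv] _; exists (vadd (vscal t xu) (vscal (1 - t) xv)).
    intros i hi; rewrite (hlin t (1 - t) xu xv i hi); unfold vadd, vscal.
    rewrite (hu i hi), (hv i hi); reflexivity. }
  assert (Kcl : closedR d K).
  { intros s l hs hl; destruct (fun_choice _ hs) as [x hx].
    destruct (wnorm_complete (d := d) ones_pos x) as [xl hxl].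
    { intros e he.
      destruct (vcv_wnorm (d := d) ones_pos _ _ hl (c * sqrt e / 2)) as [N hN].
      { apply Rdiv_lt_0_compat; [|lra]; apply Rmult_lt_0_compat; [exact hc|].
        apply sqrt_lt_R0, he. }
      exists N; intros j k hj hk.
      pose proof (hN j hj) as h1; pose proof (hN k hk) as h2.
      unfold R_dist in h1, h2; rewrite Rminus_0_r, Rabs_pos_eq in h1, h2 by apply wnorm_nonneg.
      pose proof (wnorm_triangle (d := d) ones_pos (s j) l (s k)) as ht.
      rewrite (wnorm_sub_sym l) in ht.
      assert (hjk : wnorm d ones (vsub (s j) (s k)) <= c * sqrt e) by lra.
      pose proof (hinj (vsub (x j) (x k))) as hi.
      rewrite (wip_ext (L (vsub (x j) (x k))) (vsub (s j) (s k)) (L (vsub (x j) (x k)))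
                 (vsub (s j) (s k))) in hi.
      - rewrite <- (wnorm_sq ones_pos (vsub (s j) _)) in hi.
        pose proof (wnorm_nonneg (d := d) (w := ones) (vsub (s j) (s k))).
        pose proof (sqrt_pos e); pose proof (sqrt_sqrt e ltac:(lra)) as hse.
        apply Rmult_le_reg_l with (c * c); [nra|].
        eapply Rle_trans; [exact hi|].
        replace (c * c * e) with ((c * sqrt e) * (c * sqrt e))
          by (rewrite <- hse at 3; ring).
        apply Rmult_le_compat; lra.
      - intros i hi'; rewrite (hsub _ _ i hi'); unfold vsub; rewrite !hx; auto.
      - intros i hi'; rewrite (hsub _ _ i hi'); unfold vsub; rewrite !hx; auto. }
    exists xl; intros i hi.
    apply UL_sequence with (fun k => L (x k) i); [apply (hcont x xl hxl i hi)|].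
    apply Un_cv_ext with (fun k => s k i); [|exact (hl i hi)].
    intros k; symmetry; apply hx, hi. }
  destruct (proj_exists d K Kne Kcl Kcv b) as [p hp].
  destruct (proj1 hp) as [x hx].
  set (e := vsub b p).
  assert (hKe : K (vadd p (L e))).
  { exists (vadd (vscal 1 x) (vscal 1 e)); intros i hi.
    rewrite (hlin 1 1 x e i hi); unfold vadd, vscal; rewrite (hx i hi); ring. }
  pose proof (proj_normal d K Kcv b p _ hp hKe) as h; fold e in h.
  rewrite wip_sub_r, wip_add_r in h.
  pose proof (hcoer e) as he; pose proof (wip_nonneg (d := d) ones_pos e).
  assert (hz : veq d e (fun _ => 0)) by (apply (wip_zero ones_pos); nra).
  exists x; intros i hi; specialize (hz i hi); unfold e, vsub in hz.
  rewrite (hx i hi); lra.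
Qed.

(** * The ADMM operator *)

(** A state is one vector of length [n + m]. Its [x]-block needs no extraction: operations in
    dimension [n] read only the first [n] coordinates, so the state itself can stand for [x]. *)
Definition upper (n : nat) (s : vec) : vec := fun i => s (n + i)%nat.
Definition join (n : nat) (x v : vec) : vec :=
  fun i => if Nat.ltb i n then x i else v (i - n)%nat.
Definition join_weight (n : nat) (sigma rho : R) : nat -> R :=
  fun i => if Nat.ltb i n then sigma else rho.

Lemma join_lower n x v i : (i < n)%nat -> join n x v i = x i.
Proof. intros hi; unfold join; rewrite (proj2 (Nat.ltb_lt i n) hi); reflexivity. Qed.

Lemma join_upper n x v i : join n x v (n + i)%nat = v i.
Proof.
  unfold join; rewrite (proj2 (Nat.ltb_ge (n + i) n)) by lia.
  f_equal; lia.
Qed.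

Lemma upper_join n x v : upper n (join n x v) = v.
Proof. apply functional_extensionality; intros i; apply join_upper. Qed.

Lemma join_weight_pos n sigma rho : 0 < sigma -> 0 < rho -> forall i, 0 < join_weight n sigma rho i.
Proof. intros hs hr i; unfold join_weight; destruct Nat.ltb; assumption. Qed.

Lemma wip_join n m sigma rho s t :
  wip (n + m) (join_weight n sigma rho) s t
  = sigma * wip n ones s t + rho * wip m ones (upper n s) (upper n t).
Proof.
  unfold wip; rewrite fsum_split, <- !fsum_scal; f_equal; apply fsum_ext; intros i hi.
  - unfold join_weight, ones; rewrite (proj2 (Nat.ltb_lt i n) hi); ring.
  - unfold join_weight, ones, upper; rewrite (proj2 (Nat.ltb_ge (n + i) n)) by lia; ring.
Qed.

Lemma wip_join_parts n m sigma rho x v x' v' :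
  wip (n + m) (join_weight n sigma rho) (join n x v) (join n x' v')
  = sigma * wip n ones x x' + rho * wip m ones v v'.
Proof.
  rewrite wip_join, !upper_join; f_equal; f_equal.
  apply wip_ext; intros i hi; apply join_lower, hi.
Qed.

Lemma upper_norm_le n m sigma rho s : 0 < sigma -> 0 < rho ->
  wnorm m ones (upper n s) <= / sqrt rho * wnorm (n + m) (join_weight n sigma rho) s.
Proof.
  intros hs hr; pose proof (sqrt_lt_R0 rho hr) as hq.
  apply Rmult_le_reg_l with (sqrt rho); [exact hq|].
  rewrite <- Rmult_assoc, Rinv_r, Rmult_1_l by lra.
  unfold wnorm; rewrite <- sqrt_mult_alt by lra; apply sqrt_le_1_alt.
  rewrite wip_join; pose proof (wip_nonneg (d := n) ones_pos s); nra.
Qed.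

(** The linear system of the algorithm with [u] in place of [z^k - y^k / rho] and the second row
    divided by [rho]. It is the optimality condition for minimising the objective plus [sigma / 2
    |xt - x|^2 + rho / 2 |A xt - u|^2]. *)
Definition prox_sol (n m : nat) (P : mat) (q : vec) (A : mat) (rho sigma : R)
  (x u xt zt : vec) : Prop :=
  veq n (fun i => mv n n P xt i + sigma * xt i + rho * mtv m n A zt i)
        (fun i => sigma * x i + rho * mtv m n A u i - q i) /\
  veq m zt (mv m n A xt).

Lemma prox_sol_ext n m P q A rho sigma x x' u u' xt zt :
  veq n x x' -> veq m u u' ->
  prox_sol n m P q A rho sigma x u xt zt -> prox_sol n m P q A rho sigma x' u' xt zt.
Proof.
  intros hx hu [h1 h2]; split; [|exact h2].
  intros i hi; rewrite (h1 i hi), (hx i hi), (mtv_ext m n A u u' hu); reflexivity.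
Qed.

Section Operator.
Context (n m : nat) (P : mat) (q : vec) (A : mat) (C : vec -> Prop) (rho sigma alpha : R)
  (HP : psd n P) (HCcl : closedR m C) (HCcv : convexR C)
  (Hrho : 0 < rho) (Hsigma : 0 < sigma) (Halpha : 0 < alpha < 2).

Local Notation ipn := (wip n ones).
Local Notation ipm := (wip m ones).
Local Notation W := (join_weight n sigma rho).
Local Notation sol := (prox_sol n m P q A rho sigma).
Local Notation normW := (wnorm (n + m) W).

Let HW : forall i, 0 < W i := join_weight_pos n sigma rho Hsigma Hrho.

Lemma psd_wip x : 0 <= ipn x (mv n n P x).
Proof. rewrite <- inner_wip; apply HP. Qed.

(** Eliminating [zt] leaves the matrix [P + sigma I + rho A^T A], coercive with constant [sigma]. *)
Lemma prox_exists x u : exists xt, sol x u xt (mv m n A xt).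
Proof.
  destruct (coercive_surjective n
    (fun x => vadd (vadd (mv n n P x) (vscal sigma x)) (vscal rho (mtv m n A (mv m n A x))))
    sigma Hsigma) with (b := fun i => sigma * x i + rho * mtv m n A u i - q i) as [xt hxt].
  - intros a b s t i hi; rewrite !mv_lin, mtv_lin; unfold vadd, vscal; ring.
  - intros s l h i hi; unfold vadd, vscal.
    apply (CV_plus (fun k => mv n n P (s k) i + sigma * s k i)).
    + apply (CV_plus (fun k => mv n n P (s k) i)); [apply (mv_cv n n P s l h i hi)|].
      apply Un_cv_scal, h, hi.
    + apply Un_cv_scal, (mtv_cv m n A _ _ (mv_cv m n A s l h) i hi).
  - intros y; rewrite !wip_add_r, !wip_scal_r, <- mv_adjoint.
    pose proof (psd_wip y); pose proof (wip_nonneg (d := m) ones_pos (mv m n A y)); nra.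
  - exists xt; split; [|intros i hi; reflexivity].
    intros i hi; rewrite <- (hxt i hi); reflexivity.
Qed.

(** Subtract the two systems and test with [xt - xt']; the [P]-term is nonnegative and is
    dropped. *)
Lemma prox_firm x u xt zt x' u' xt' zt' :
  sol x u xt zt -> sol x' u' xt' zt' ->
  sigma * ipn (vsub xt xt') (vsub xt xt') + rho * ipm (vsub zt zt') (vsub zt zt')
  <= sigma * ipn (vsub xt xt') (vsub x x') + rho * ipm (vsub zt zt') (vsub u u').
Proof.
  intros [h1 h2] [h1' h2'].
  set (d := vsub xt xt').
  assert (hd : forall y, ipm (vsub zt zt') y = ipn d (mtv m n A y)).
  { intros y; rewrite <- mv_adjoint; unfold d; rewrite mv_sub; apply wip_ext.
    - intros i hi; unfold vsub; rewrite (h2 i hi), (h2' i hi); reflexivity.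
    - intros i hi; reflexivity. }
  assert (heq : veq n (vadd (vadd (mv n n P d) (vscal sigma d))
                         (vscal rho (mtv m n A (vsub zt zt'))))
                      (vadd (vscal sigma (vsub x x')) (vscal rho (mtv m n A (vsub u u'))))).
  { intros i hi; specialize (h1 i hi); specialize (h1' i hi).
    unfold d; rewrite mv_sub, !mtv_sub; unfold vadd, vscal, vsub; lra. }
  pose proof (wip_ext (w := ones) d d _ _ (fun i _ => eq_refl) heq) as h.
  rewrite !wip_add_r, !wip_scal_r, <- !hd in h.
  pose proof (psd_wip d); lra.
Qed.

Lemma prox_perturb x u xt zt u' xt' zt' :
  sol x u xt zt -> sol x u' xt' zt' ->
  normW (join n (vsub xt xt') (vsub zt zt')) <= normW (join n (fun _ => 0) (vsub u u')).
Proof.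
  intros h h'; pose proof (prox_firm _ _ _ _ _ _ _ _ h h') as hf.
  set (a := join n (vsub xt xt') (vsub zt zt')).
  set (b := join n (fun _ => 0) (vsub u u')).
  pose proof (cauchy_schwarz (d := n + m) HW a b) as hcs.
  pose proof (wnorm_sq (d := n + m) HW a) as hq.
  unfold a at 3 4 in hq; unfold a at 1, b at 1 in hcs; rewrite wip_join_parts in hq, hcs.
  rewrite (wip_ext _ (vsub xt xt') (fun _ => 0) (vsub x x)) in hcs.
  - pose proof (wnorm_nonneg (d := (n + m)%nat) (w := W) a).
    pose proof (wnorm_nonneg (d := (n + m)%nat) (w := W) b).
    apply Rnot_lt_le; intros hlt; nra.
  - intros i hi; reflexivity.
  - intros i hi; unfold vsub; ring.
Qed.

Lemma prox_unique x u xt zt xt' zt' :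
  sol x u xt zt -> sol x u xt' zt' -> veq n xt xt' /\ veq m zt zt'.
Proof.
  intros h h'; pose proof (prox_firm _ _ _ _ _ _ _ _ h h') as hf.
  rewrite (wip_sub_r x x), (wip_sub_r u u) in hf.
  pose proof (wip_nonneg (d := n) ones_pos (vsub xt xt')).
  pose proof (wip_nonneg (d := m) ones_pos (vsub zt zt')).
  assert (hx : veq n (vsub xt xt') (fun _ => 0)) by (apply (wip_zero ones_pos); nra).
  assert (hz : veq m (vsub zt zt') (fun _ => 0)) by (apply (wip_zero ones_pos); nra).
  split; intros i hi; [specialize (hx i hi) as e|specialize (hz i hi) as e];
    unfold vsub in e; lra.
Qed.

Definition reflect (p v : vec) : vec := fun i => 2 * p i - v i.

(** One exact, relaxed step: with [p] the projection of [v] one has [z = p] and [y / rho = v - p],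
    so [z - y / rho] is the reflection [2 p - v], and the updates amount to [v + alpha (zt - p)].
    The [x]-block is unconstrained, so there projection and reflection are the identity. *)
Definition admm_op (proj : vec -> vec) (prox : vec * vec -> vec) (s : vec) : vec :=
  let v := upper n s in
  let p := proj v in
  let xt := prox (s, reflect p v) in
  join n (vadd s (vscal alpha (vsub xt s)))
         (vadd v (vscal alpha (vsub (mv m n A xt) p))).

Context (proj : vec -> vec) (prox : vec * vec -> vec)
  (Hproj : forall v, is_proj m C v (proj v))
  (Hprox : forall xu, sol (fst xu) (snd xu) (prox xu) (mv m n A (prox xu))).

(** The operator is [alpha / 2]-averaged, and [(1 - alpha / 2) / (alpha / 2)] is the constant
    below. *)
Lemma admm_op_averaged :
  averaged (n + m) W ((2 - alpha) / alpha) (admm_op proj prox).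
Proof.
  intros a b.
  set (p := vsub (proj (upper n a)) (proj (upper n b))).
  set (v := vsub (upper n a) (upper n b)).
  set (xa := prox (a, reflect (proj (upper n a)) (upper n a))).
  set (xb := prox (b, reflect (proj (upper n b)) (upper n b))).
  set (ex := vsub (vsub xa xb) (vsub a b)).
  set (z := vsub (mv m n A xa) (mv m n A xb)).
  set (ez := vsub z p).
  pose proof (proj_firm m C HCcv _ _ _ _ (Hproj (upper n a)) (Hproj (upper n b))) as h1.
  pose proof (prox_firm _ _ _ _ _ _ _ _
                (Hprox (a, reflect (proj (upper n a)) (upper n a)))
                (Hprox (b, reflect (proj (upper n b)) (upper n b)))) as h2.
  cbn [fst snd] in h2; fold xa xb in h2; fold p v in h1; fold z in h2.
  replace (vsub (reflect _ _) (reflect _ _)) with (vsub (vscal 2 p) v) in h2 by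
    (apply functional_extensionality; intros i; unfold p, v, reflect, vsub, vscal; ring).
  assert (e1 : veq n (vsub (admm_op proj prox a) (admm_op proj prox b))
                     (vadd (vsub a b) (vscal alpha ex))).
  { intros i hi; unfold admm_op; cbv zeta; fold xa xb.
    unfold ex, vadd, vsub, vscal; rewrite !join_lower by exact hi; ring. }
  assert (e2 : upper n (vsub (admm_op proj prox a) (admm_op proj prox b))
               = vadd v (vscal alpha ez)).
  { apply functional_extensionality; intros i; unfold admm_op; cbv zeta; fold xa xb.
    unfold ez, z, p, v, vadd, vsub, vscal, upper; rewrite !join_upper; ring. }
  set (E := vsub (vsub (admm_op proj prox a) a) (vsub (admm_op proj prox b) b)).
  assert (e3 : veq n E (vscal alpha ex)).
  { intros i hi; specialize (e1 i hi); unfold E, vadd, vsub, vscal in *; lra. }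
  assert (e4 : upper n E = vscal alpha ez).
  { apply functional_extensionality; intros i; apply (f_equal (fun f => f i)) in e2.
    unfold E, v, upper, vadd, vsub, vscal in *; lra. }
  rewrite !wip_join, e2, e4, (wip_ext _ _ _ _ e1 e1), (wip_ext _ _ _ _ e3 e3).
  change (upper n (vsub a b)) with v.
  unfold ex, ez; set (x := vsub xa xb) in *; set (y := vsub a b) in *.
  wip_expand; wip_expand_in h1; wip_expand_in h2.
  rewrite (wip_sym y x), (wip_sym p z), (wip_sym v z), (wip_sym v p) in *.
  apply (Rmult_le_compat_l rho) in h1; [|lra].
  apply Rminus_le.
  (* Since [1 + beta = 2 / alpha], the difference of the two sides is exactly [2 alpha] times the
     sum of the two firm-nonexpansiveness defects, the projection one weighted by [rho]. *)
  replace (_ - _) with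
    (2 * alpha * ((sigma * ipn x x + rho * ipm z z)
                  - (sigma * ipn x y + rho * (2 * ipm z p - ipm z v))
                  + (rho * ipm p p - rho * ipm p v))) by (field; lra).
  rewrite <- (Rmult_0_r (2 * alpha)); apply Rmult_le_compat_l; lra.
Qed.

Lemma proj_unique v p : is_proj m C v p -> veq m (proj v) p.
Proof.
  intros hp; pose proof (proj_firm m C HCcv _ _ _ _ (Hproj v) hp) as h.
  rewrite (wip_sub_r v v) in h.
  assert (h0 : veq m (vsub (proj v) p) (fun _ => 0)) by (apply (wip_zero ones_pos); lra).
  intros i hi; specialize (h0 i hi); unfold vsub in h0; lra.
Qed.

(** The fixed point is [(xb, zb + yb / rho)]: normality of [yb] makes [zb] the projection of the
    second block, whose reflection is then [zb - yb / rho]. *)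
Lemma KKT_fixed_point xb zb yb :
  is_KKT n m P q A C xb zb yb ->
  exists f, veq (n + m) (admm_op proj prox f) f.
Proof.
  intros [hs [hA [hC hN]]].
  set (v := vadd zb (vscal (/ rho) yb)); exists (join n xb v).
  assert (hp : veq m (proj v) zb).
  { apply proj_unique, (normal_proj m C v zb hC); intros c hc.
    rewrite (wip_ext (vsub v zb) (vscal (/ rho) yb) (vsub c zb) (vsub c zb)) by
      (intros i _; try reflexivity; unfold v, vsub, vadd, vscal; ring).
    rewrite wip_scal_l, <- inner_wip; pose proof (hN c hc) as h.
    change (inner m yb (vsub c zb) <= 0) in h.
    assert (0 < / rho) by (apply Rinv_0_lt_compat, Hrho); nra. }
  assert (hsol : sol (join n xb v) (reflect (proj v) v) xb zb).
  { split; [|intros i hi; symmetry; apply hA, hi].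
    intros i hi; rewrite join_lower by exact hi.
    rewrite (mtv_ext m n A (reflect (proj v) v) (vadd (vscal 1 zb) (vscal (- / rho) yb))).
    - rewrite mtv_lin; specialize (hs i hi); cbv beta in hs; unfold vadd, vscal.
      replace (rho * (1 * mtv m n A zb i + - / rho * mtv m n A yb i))
        with (rho * mtv m n A zb i - mtv m n A yb i) by (field; lra); lra.
    - intros j hj; unfold reflect; rewrite (hp j hj); unfold v, vadd, vscal; ring. }
  destruct (prox_unique _ _ _ _ _ _ (Hprox (join n xb v, reflect (proj v) v)) hsol)
    as [hx hz].
  intros i hi; unfold admm_op; cbv zeta; rewrite upper_join.
  destruct (Nat.lt_ge_cases i n) as [hin|hin].
  - rewrite !join_lower by exact hin; unfold vadd, vscal, vsub.
    rewrite (hx i hin), join_lower by exact hin; ring.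
  - replace i with (n + (i - n))%nat by lia; rewrite !join_upper.
    unfold vadd, vscal, vsub; rewrite (hz (i - n)%nat), (hp (i - n)%nat) by lia; ring.
Qed.

Lemma fixed_point_KKT s :
  veq (n + m) (admm_op proj prox s) s ->
  is_KKT n m P q A C s (proj (upper n s)) (vscal rho (vsub (upper n s) (proj (upper n s)))).
Proof.
  intros hs; set (v := upper n s) in *; set (p := proj v) in *.
  set (xt := prox (s, reflect p v)).
  assert (hx : veq n xt s).
  { intros i hi; specialize (hs i ltac:(lia)); unfold admm_op in hs; cbv zeta in hs.
    fold v p xt in hs; rewrite join_lower in hs by exact hi.
    unfold vadd, vscal, vsub in hs; apply Rmult_eq_reg_l with alpha; lra. }
  assert (hz : veq m (mv m n A xt) p).
  { intros i hi; specialize (hs (n + i)%nat ltac:(lia)); unfold admm_op in hs; cbv zeta in hs.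
    fold v p xt in hs; rewrite join_upper in hs; change (s (n + i)%nat) with (v i) in hs.
    unfold vadd, vscal, vsub in hs; apply Rmult_eq_reg_l with alpha; lra. }
  destruct (Hprox (s, reflect p v)) as [h1 _]; cbn [fst snd] in h1; fold xt in h1.
  split; [|split; [|split]].
  - intros i hi; specialize (h1 i hi); cbv beta in h1.
    rewrite (mv_ext n n P xt s hx), (hx i hi), (mtv_ext m n A _ p hz) in h1.
    replace (vscal rho (vsub v p)) with
      (vadd (vscal rho p) (vscal (- rho) (reflect p v))) by
      (apply functional_extensionality; intros j; unfold reflect, vadd, vscal, vsub; ring).
    rewrite mtv_lin; unfold vadd, vscal; lra.
  - rewrite <- (mv_ext m n A xt s hx); exact hz.
  - apply (Hproj v).
  - intros c hc; change (inner m (vscal rho (vsub v p)) (vsub c p) <= 0).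
    rewrite inner_wip, wip_scal_l.
    pose proof (proj_normal m C HCcv v p c (Hproj v) hc); nra.
Qed.

(** * The iterates as an inexact orbit *)

Section Iterates.
Context (mu nu : nat -> R) (x z y xtl ztl : nat -> vec)
  (Hiter : admm_iterates n m P q A C rho sigma alpha mu nu x z y xtl ztl).

(** The index is shifted by one because [z 0] and [y 0] need not be related through a projection. *)
Definition iterate_state (k : nat) : vec :=
  join n (x (S k)) (vadd (z (S k)) (vscal (/ rho) (y (S k)))).

(** By the [y]-update, the point projected in the [z]-update is exactly
    [z (S k) + y (S k) / rho]. *)
Lemma iterate_z_error k :
  wnorm m ones (vsub (z (S k)) (proj (upper n (iterate_state k)))) <= nu k.
Proof.
  destruct (Hiter k) as [_ [_ [[p [hp hz]] hy]]].
  change (norm2 m (vsub (z (S k)) p) <= nu k) in hz; rewrite norm2_wnorm in hz.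
  set (v := vadd (z (S k)) (vscal (/ rho) (y (S k)))).
  unfold iterate_state; rewrite upper_join; fold v.
  set (a := fun i => alpha * ztl (S k) i + (1 - alpha) * z k i + y k i / rho) in hp.
  assert (hv : veq m v a).
  { intros i hi; unfold v, a, vadd, vscal; rewrite (hy i hi); field; lra. }
  pose proof (proj_nonexpansive m C HCcv _ _ _ _ hp (Hproj v)) as h.
  rewrite (wnorm_ext (vsub a v) (vscal 0 v)), wnorm_scal, Rabs_R0 in h.
  - pose proof (wnorm_triangle (d := m) ones_pos (z (S k)) p (proj v)); lra.
  - intros i hi; unfold vsub, vscal; rewrite (hv i hi); ring.
Qed.

Lemma normW_lower_zero r :
  normW (join n (fun _ => 0) r) = sqrt rho * wnorm m ones r.
Proof.
  unfold wnorm; rewrite wip_join_parts, <- sqrt_mult_alt by lra; f_equal.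
  rewrite wip_zero_r by (intros i _; reflexivity); ring.
Qed.

(** Three errors add up: [a] from the inexact solve, [c] from relaxing with [z] instead of the
    projection, and [b] from solving with [z] reflected instead, which doubles [c]; hence the factor
    3. The factor [sqrt (sigma + rho)] compares the weighted and Euclidean norms. The projection
    error of the current step cancels in [z + y / rho], so [nu] enters with the earlier index. *)
Lemma iterate_inexact k :
  normW (vsub (iterate_state (S k)) (admm_op proj prox (iterate_state k)))
  <= (alpha * sqrt (sigma + rho)) * mu (S k) + (alpha * (3 * sqrt rho)) * nu k.
Proof.
  destruct (Hiter (S k)) as [[xh [zh [hs1 [hs2 hmu]]]] [hx [_ hy]]].
  pose proof (iterate_z_error k) as hz.
  set (K := S k) in *; set (s := iterate_state k) in *.
  set (v := upper n s) in *; set (p := proj v) in *; set (X := prox (s, reflect p v)).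
  assert (hv : v = vadd (z K) (vscal (/ rho) (y K))) by apply upper_join.
  assert (hsx : veq n s (x K)) by (intros i hi; apply join_lower, hi).
  assert (hh : sol (x K) (reflect (z K) v) xh zh).
  { split.
    - intros i hi; rewrite (hs1 i hi).
      rewrite (mtv_ext m n A (fun l => z K l - y K l / rho) (reflect (z K) v)); [reflexivity|].
      intros j hj; rewrite hv; unfold reflect, vadd, vscal; field; lra.
    - intros i hi; specialize (hs2 i hi); cbv beta in hs2.
      apply Rmult_eq_reg_l with rho; lra. }
  pose proof (prox_sol_ext _ _ _ _ _ _ _ _ _ _ _ _ _ hsx (fun i _ => eq_refl)
                (Hprox (s, reflect p v))) as hX.
  cbn [fst snd] in hX; fold X in hX.
  set (a := join n (vsub (xtl (S K)) xh) (vsub (ztl (S K)) zh)).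
  set (b := join n (vsub xh X) (vsub zh (mv m n A X))).
  set (c := join n (fun _ => 0) (vsub (z K) p)).
  assert (hdec : veq (n + m) (vsub (iterate_state K) (admm_op proj prox s))
                   (vscal alpha (vadd (vadd a b) (vscal (-1) c)))).
  { intros i hi; unfold vscal, vadd, vsub, admm_op; cbv zeta; fold v p X.
    destruct (Nat.lt_ge_cases i n) as [hin|hin].
    - unfold iterate_state, a, b, c; rewrite !join_lower by exact hin.
      unfold vadd, vscal, vsub; rewrite (hx i hin), (hsx i hin); ring.
    - replace i with (n + (i - n))%nat by lia; set (j := (i - n)%nat).
      unfold iterate_state, a, b, c; rewrite !join_upper.
      assert (hj : (j < m)%nat) by (unfold j; lia).
      rewrite hv; unfold vadd, vscal, vsub; rewrite (hy j hj); field; lra. }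
  rewrite (wnorm_ext _ _ hdec), wnorm_scal, Rabs_pos_eq by lra.
  assert (ha : normW a <= sqrt (sigma + rho) * mu K).
  { unfold wnorm, a; rewrite wip_join_parts.
    apply Rle_trans with (sqrt (sigma + rho) *
      sqrt (fsum n (fun i => (xtl (S K) i - xh i) ^ 2)
            + fsum m (fun i => (ztl (S K) i - zh i) ^ 2))).
    - rewrite <- sqrt_mult_alt by lra; apply sqrt_le_1_alt.
      rewrite (fsum_ext n (fun i => (xtl (S K) i - xh i) ^ 2)
                 (fun i => ones i * (vsub (xtl (S K)) xh i * vsub (xtl (S K)) xh i)))
        by (intros; unfold ones, vsub; ring).
      rewrite (fsum_ext m (fun i => (ztl (S K) i - zh i) ^ 2)
                 (fun i => ones i * (vsub (ztl (S K)) zh i * vsub (ztl (S K)) zh i)))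
        by (intros; unfold ones, vsub; ring).
      fold (wip n ones (vsub (xtl (S K)) xh) (vsub (xtl (S K)) xh)).
      fold (wip m ones (vsub (ztl (S K)) zh) (vsub (ztl (S K)) zh)).
      pose proof (wip_nonneg (d := n) ones_pos (vsub (xtl (S K)) xh)).
      pose proof (wip_nonneg (d := m) ones_pos (vsub (ztl (S K)) zh)); nra.
    - apply Rmult_le_compat_l; [apply sqrt_pos|exact hmu]. }
  assert (hc : normW c <= sqrt rho * nu k).
  { unfold c; rewrite normW_lower_zero.
    apply Rmult_le_compat_l; [apply sqrt_pos|exact hz]. }
  assert (hb : normW b <= 2 * normW c).
  { eapply Rle_trans; [apply (prox_perturb _ _ _ _ _ _ _ hh hX)|].
    replace (vsub (reflect (z K) v) (reflect p v)) with (vscal 2 (vsub (z K) p)) by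
      (apply functional_extensionality; intros i; unfold reflect, vscal, vsub; ring).
    unfold c; rewrite !normW_lower_zero, wnorm_scal, Rabs_pos_eq by lra; lra. }
  pose proof (wnorm_add (d := n + m) HW (vadd a b) (vscal (-1) c)) as t1.
  pose proof (wnorm_add (d := n + m) HW a b) as t2.
  rewrite wnorm_scal, (Rabs_left (-1)) in t1 by lra.
  rewrite !Rmult_assoc, <- Rmult_plus_distr_l; apply Rmult_le_compat_l; lra.
Qed.

End Iterates.

(** * Infeasibility certificates *)

(** Semidefiniteness at [x - t P x] gives [2 |P x|^2] bounded by a multiple of [t]. *)
Lemma psd_kernel x : ipn x (mv n n P x) <= 0 -> veq n (mv n n P x) (fun _ => 0).
Proof.
  intros hx; set (g := mv n n P x).
  assert (hsym : ipn x (mv n n P g) = ipn g g).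
  { unfold g at 2; rewrite (mv_adjoint n n P x g); apply fsum_ext; intros i hi.
    f_equal; f_equal; apply fsum_ext; intros j hj; rewrite (proj1 HP i j hi hj); reflexivity. }
  apply (wip_zero ones_pos).
  enough (2 * ipn g g <= 0) by lra.
  apply small_quadratic with (ipn g (mv n n P g)); intros t ht.
  pose proof (psd_wip (vadd (vscal 1 x) (vscal (- t) g))) as h.
  rewrite mv_lin in h; fold g in h; wip_expand_in h.
  rewrite hsym in h; fold g in hx.
  apply Rmult_le_reg_l with t; lra.
Qed.

Context (delta : vec)
  (Hdelta : forall t, trajectory (admm_op proj prox) t -> vcv (n + m) (increment t) delta)
  (Hmin : forall s, wip (n + m) W delta delta
                    <= wip (n + m) W (vsub (admm_op proj prox s) s) delta).

Local Notation pj s := (proj (upper n s)).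
Local Notation xt s := (prox (s, reflect (proj (upper n s)) (upper n s))).
Local Notation zt s := (mv m n A (prox (s, reflect (proj (upper n s)) (upper n s)))).
Local Notation dual s := (vscal rho (vsub (upper n s) (proj (upper n s)))).

(** The [x]-part of the limit is [delta] itself, read in dimension [n]. *)
Local Notation dv := (upper n delta).
Local Notation dz := (mv m n A delta).
Local Notation dy := (vscal rho (vsub (upper n delta) (mv m n A delta))).

Lemma optimality s : veq n
  (vadd (vadd (mv n n P (xt s)) (vscal sigma (vsub (xt s) s)))
        (vadd (mtv m n A (vadd (vscal rho (vsub (zt s) (pj s))) (dual s))) q))
  (fun _ => 0).
Proof.
  destruct (Hprox (s, reflect (pj s) (upper n s))) as [h _]; cbn [fst snd] in h.
  replace (vadd (vscal rho (vsub (zt s) (pj s))) (dual s)) with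
    (vadd (vscal rho (zt s)) (vscal (- rho) (reflect (pj s) (upper n s)))) by
    (apply functional_extensionality; intros i; unfold reflect, vadd, vscal, vsub; ring).
  rewrite mtv_lin; intros i hi; specialize (h i hi); cbv beta in h.
  unfold vadd, vscal, vsub; lra.
Qed.

Section Trajectory.
Context (t : nat -> vec) (Ht : trajectory (admm_op proj prox) t).

Lemma step_lower k : veq n (increment t k) (vscal alpha (vsub (xt (t k)) (t k))).
Proof.
  intros i hi; unfold increment; rewrite Ht; unfold admm_op; cbv zeta.
  unfold vsub at 1; rewrite join_lower by exact hi; unfold vadd; ring.
Qed.

Lemma step_upper k : upper n (increment t k) = vscal alpha (vsub (zt (t k)) (pj (t k))).
Proof.
  apply functional_extensionality; intros i; unfold increment, upper at 1; rewrite Ht.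
  unfold admm_op; cbv zeta; unfold vsub at 1; rewrite join_upper; unfold vadd, upper; ring.
Qed.

Lemma lower_cv : vcv n (increment t) delta.
Proof. intros i hi; apply (Hdelta t Ht); lia. Qed.

Lemma upper_cv : vcv m (fun k => upper n (increment t k)) dv.
Proof. intros i hi; apply (Hdelta t Ht (n + i)%nat); lia. Qed.

Lemma xt_gap_cv : vcv n (fun k => vsub (xt (t k)) (t k)) (vscal (/ alpha) delta).
Proof.
  intros i hi; apply Un_cv_ext with (fun k => / alpha * increment t k i).
  - intros k; rewrite step_lower by exact hi; unfold vscal; field; lra.
  - apply Un_cv_scal, lower_cv, hi.
Qed.

Lemma zt_gap_cv : vcv m (fun k => vsub (zt (t k)) (pj (t k))) (vscal (/ alpha) dv).
Proof.
  intros i hi; apply Un_cv_ext with (fun k => / alpha * upper n (increment t k) i).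
  - intros k; rewrite step_upper; unfold vscal; field; lra.
  - apply Un_cv_scal, upper_cv, hi.
Qed.

(** The gap between [xt] and the state converges, so its own increments vanish. *)
Lemma xt_increment_cv : vcv n (increment (fun k => xt (t k))) delta.
Proof.
  pose proof (vcv_increment_zero _ _ _ xt_gap_cv) as h; intros i hi.
  apply Un_cv_ext with
    (fun k => increment t k i + increment (fun k => vsub (xt (t k)) (t k)) k i).
  - intros k; unfold increment, vsub; ring.
  - apply Un_cv_limit_ext with (delta i + 0); [|ring].
    apply CV_plus; [apply lower_cv, hi|apply h, hi].
Qed.

(** The projections inherit the increments of [zt = A xt] for the same reason; this is how [A dx]
    becomes the limit direction of [z]. *)
Lemma pj_increment_cv : vcv m (increment (fun k => pj (t k))) dz.
Proof.
  pose proof (vcv_increment_zero _ _ _ zt_gap_cv) as h; intros i hi.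
  apply Un_cv_ext with
    (fun k => mv m n A (increment (fun k => xt (t k)) k) i
              - increment (fun k => vsub (zt (t k)) (pj (t k))) k i).
  - intros k; unfold increment at 1; rewrite mv_sub; unfold increment, vsub; ring.
  - apply Un_cv_limit_ext with (dz i - 0); [|ring].
    apply CV_minus; [apply (mv_cv m n A _ _ xt_increment_cv i hi)|apply h, hi].
Qed.

Lemma dual_increment_cv : vcv m (increment (fun k => dual (t k))) dy.
Proof.
  intros i hi; apply Un_cv_ext with
    (fun k => rho * (upper n (increment t k) i - increment (fun k => pj (t k)) k i)).
  - intros k; unfold increment, vscal, vsub, upper; ring.
  - apply Un_cv_scal, CV_minus; [apply upper_cv, hi|apply pj_increment_cv, hi].
Qed.

End Trajectory.

Let t0 : nat -> vec := fun k => Nat.iter k (admm_op proj prox) (fun _ => 0).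
Let Ht0 : trajectory (admm_op proj prox) t0 := trajectory_iter _ _.

(** [c + r dz] is the limit of the convex combinations with weight [r / k] on the [k]-th projection
    and the rest on [c]; the shift in [f] ensures [r <= k]. *)
Lemma dz_recession : in_recession_cone C dz.
Proof.
  intros c r hc hr.
  destruct (INR_unbounded r) as [K hK].
  set (f := fun k => (S K + k)%nat).
  assert (hf : forall k, r < INR (f k) /\ 0 < INR (f k)).
  { intros k; unfold f; split; [|apply lt_0_INR; lia].
    apply Rlt_le_trans with (INR K); [exact hK|apply le_INR; lia]. }
  apply (HCcl (fun k => vadd (vscal (r / INR (f k)) (pj (t0 (f k))))
                             (vscal (1 - r / INR (f k)) c))).
  - intros k; destruct (hf k); apply HCcv; [apply Hproj|exact hc|]; split.
    + apply Rle_mult_inv_pos; lra.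
    + apply Rmult_le_reg_r with (INR (f k)); [lra|]; unfold Rdiv.
      rewrite Rmult_assoc, Rinv_l; lra.
  - intros i hi.
    set (u := fun k => pj (t0 k)).
    pose proof (vcv_average m (fun k => vsub (u k) c) dz) as h.
    assert (hinc : vcv m (increment (fun k => vsub (u k) c)) dz).
    { intros j hj; apply Un_cv_ext with (fun k => increment u k j).
      - intros; unfold increment, vsub; ring.
      - apply (pj_increment_cv t0 Ht0 j hj). }
    specialize (h hinc i hi); cbv beta in h.
    apply (Un_cv_comp _ _ f) in h; [|intros; unfold f; lia].
    apply (Un_cv_scal r) in h.
    apply Un_cv_ext with (fun k => c i + r * vscal (/ INR (f k)) (vsub (u (f k)) c) i).
    + intros k; unfold u, vscal, vadd, vsub, Rdiv; ring.
    + apply (CV_plus (fun _ => c i)); [apply Un_cv_const|exact h].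
Qed.

Lemma dual_recession s d : in_recession_cone C d -> ipm (dual s) d <= 0.
Proof.
  intros hd.
  pose proof (proj_normal m C HCcv _ _ _ (Hproj (upper n s))
                (hd (pj s) 1 (proj1 (Hproj (upper n s))) Rle_0_1)) as h.
  rewrite (wip_ext _ (vsub (upper n s) (pj s)) _ d) in h by
    (intros i hi; unfold vsub; ring).
  rewrite wip_scal_l; nra.
Qed.

(** Subtracting consecutive optimality conditions cancels [q], and the convergent gap in the
    [sigma]-term contributes nothing. *)
Lemma stationarity_limit : veq n (vadd (mv n n P delta) (mtv m n A dy)) (fun _ => 0).
Proof.
  set (U := fun k => vadd (vscal rho (vsub (zt (t0 k)) (pj (t0 k)))) (vscal 1 (dual (t0 k)))).
  assert (hU : vcv m (increment U) dy).
  { intros i hi; apply Un_cv_ext with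
      (fun k => rho * increment (fun k => vsub (zt (t0 k)) (pj (t0 k))) k i
                + increment (fun k => dual (t0 k)) k i).
    - intros k; unfold U, increment, vadd, vscal, vsub; ring.
    - apply Un_cv_limit_ext with (rho * 0 + dy i); [|ring].
      apply CV_plus; [apply Un_cv_scal|apply (dual_increment_cv t0 Ht0 i hi)].
      apply (vcv_increment_zero _ _ _ (zt_gap_cv t0 Ht0) i hi). }
  intros i hi; apply UL_sequence with
    (fun k => mv n n P (increment (fun k => xt (t0 k)) k) i
              + mtv m n A (increment U k) i
              + sigma * increment (fun k => vsub (xt (t0 k)) (t0 k)) k i).
  - apply Un_cv_limit_ext with (mv n n P delta i + mtv m n A dy i + sigma * 0);
      [|unfold vadd; ring].
    apply CV_plus; [apply CV_plus|apply Un_cv_scal].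
    + apply (mv_cv n n P _ _ (xt_increment_cv t0 Ht0) i hi).
    + apply (mtv_cv m n A _ _ hU i hi).
    + apply (vcv_increment_zero _ _ _ (xt_gap_cv t0 Ht0) i hi).
  - apply Un_cv_ext with (fun _ => 0); [|apply Un_cv_const].
    intros k; unfold increment; rewrite mv_sub, mtv_sub.
    assert (ho : forall s, mv n n P (xt s) i + sigma * (xt s i - s i)
      + (mtv m n A (vadd (vscal rho (vsub (zt s) (pj s))) (dual s)) i + q i) = 0)
      by (intros s; exact (optimality s i hi)).
    pose proof (ho (t0 k)) as h; pose proof (ho (t0 (S k))) as h'.
    assert (hUk : forall k, U k = vadd (vscal rho (vsub (zt (t0 k)) (pj (t0 k)))) (dual (t0 k))).
    { intros j; apply functional_extensionality; intros l; unfold U, vadd, vscal; ring. }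
    rewrite <- hUk in h, h'; set (x1 := xt (t0 (S k))) in *; set (x0 := xt (t0 k)) in *.
    unfold vsub; lra.
Qed.

(** Each dual vector is normal at its projection; testing against the first projection and dividing
    by [k^2] gives the sign. Stationarity tested with [dx] equates the sum of this product and the
    [P]-form of [dx] to 0, so both vanish. *)
Lemma dual_dz_nonneg : 0 <= ipm dy dz.
Proof.
  set (c := pj (t0 O)).
  assert (h1 : vcv m (fun k => vscal (/ INR k) (dual (t0 k))) dy)
    by apply vcv_average, (dual_increment_cv t0 Ht0).
  assert (h2 : vcv m (fun k => vscal (/ INR k) (vsub (pj (t0 k)) c)) dz).
  { apply (vcv_average m (fun k => vsub (pj (t0 k)) c)).
    intros i hi; apply Un_cv_ext with (fun k => increment (fun k => pj (t0 k)) k i).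
    - intros; unfold increment, vsub; ring.
    - apply (pj_increment_cv t0 Ht0 i hi). }
  apply (Un_cv_ge _ _ _ (wip_cv (w := ones) _ _ _ _ h1 h2)); intros k.
  pose proof (proj_normal m C HCcv _ _ c (Hproj (upper n (t0 k))) (proj1 (Hproj _))) as h.
  wip_expand_in h; wip_expand.
  assert (0 <= / INR k * / INR k) by nra.
  assert (0 <= rho * (/ INR k * / INR k)) by nra.
  nra.
Qed.

Lemma dx_kernel_dy : ipn delta (mv n n P delta) + ipm dy dz = 0.
Proof.
  pose proof (wip_ext (w := ones) delta delta _ _ (fun i _ => eq_refl) stationarity_limit) as h.
  rewrite wip_add_r, <- mv_adjoint, (wip_sym dz) in h; rewrite h.
  apply wip_zero_r; intros i hi; reflexivity.
Qed.

Lemma P_dx_zero : veq n (mv n n P delta) (fun _ => 0).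
Proof.
  apply psd_kernel; pose proof dx_kernel_dy; pose proof dual_dz_nonneg; lra.
Qed.

Lemma dy_orthogonal_dz : ipm dy dz = 0.
Proof.
  pose proof dx_kernel_dy; pose proof dual_dz_nonneg; pose proof (psd_wip delta); lra.
Qed.

Lemma At_dy_zero : veq n (mtv m n A dy) (fun _ => 0).
Proof.
  intros i hi; pose proof (stationarity_limit i hi) as h; pose proof (P_dx_zero i hi) as h0.
  unfold vadd at 1 in h; lra.
Qed.

Lemma dy_image x : ipm dy (mv m n A x) = 0.
Proof.
  rewrite wip_sym, mv_adjoint; apply wip_zero_r, At_dy_zero.
Qed.

Lemma P_image_dx x : ipn delta (mv n n P x) = 0.
Proof.
  apply (psd_kernel_orthogonal n P delta x HP P_dx_zero).
Qed.

Lemma optimality_dx s :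
  sigma * ipn delta (vsub (xt s) s)
  + (rho * ipm dz (vsub (zt s) (pj s)) + ipm dz (dual s)) + ipn delta q = 0.
Proof.
  pose proof (wip_ext (w := ones) delta delta _ _ (fun i _ => eq_refl) (optimality s)) as h.
  rewrite !wip_add_r, P_image_dx, <- mv_adjoint, wip_add_r, (wip_scal_r sigma) in h.
  rewrite (wip_scal_r rho (vsub (zt s) _)) in h.
  rewrite (wip_zero_r delta (fun _ => 0)) in h by (intros i hi; reflexivity); lra.
Qed.

Lemma dv_norm : rho * ipm dv dv = rho * ipm dz dz + / rho * ipm dy dy.
Proof.
  pose proof dy_orthogonal_dz as h; wip_expand; wip_expand_in h.
  rewrite (wip_sym dz dv) in *.
  assert (h' : ipm dv dz = ipm dz dz) by (apply Rmult_eq_reg_l with rho; lra).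
  rewrite h'; field; lra.
Qed.

Lemma dz_dv : ipm dz dv = ipm dz dz.
Proof.
  pose proof dy_orthogonal_dz as h; wip_expand_in h.
  rewrite (wip_sym dz dv); apply Rmult_eq_reg_l with rho; lra.
Qed.

Lemma dy_dv : ipm dy dv = / rho * ipm dy dy.
Proof.
  pose proof dy_orthogonal_dz as h.
  rewrite (wip_scal_r rho), wip_sub_r, h; field; lra.
Qed.

Lemma q_dx_lower : - (sigma * ipn delta delta + rho * ipm dz dz) / alpha <= ipn delta q.
Proof.
  assert (h : Un_cv (fun k => sigma * ipn delta (vsub (xt (t0 k)) (t0 k))
                              + rho * ipm dz (vsub (zt (t0 k)) (pj (t0 k))))
                (sigma * ipn delta (vscal (/ alpha) delta)
                 + rho * ipm dz (vscal (/ alpha) dv))).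
  { apply CV_plus; apply Un_cv_scal; apply wip_cv; try apply vcv_const.
    - apply (xt_gap_cv t0 Ht0).
    - apply (zt_gap_cv t0 Ht0). }
  apply (Un_cv_ge _ _ (- ipn delta q)) in h.
  - rewrite !wip_scal_r, dz_dv in h.
    replace (- (sigma * ipn delta delta + rho * ipm dz dz) / alpha) with
      (- (sigma * (/ alpha * ipn delta delta) + rho * (/ alpha * ipm dz dz))) by (field; lra).
    lra.
  - intros k; pose proof (optimality_dx (t0 k)) as ho.
    pose proof (dual_recession (t0 k) dz dz_recession) as hd; rewrite wip_sym in hd; lra.
Qed.

Lemma displacement_bound c : C c ->
  ipn delta q + ipm dy c
  <= - (sigma * ipn delta delta + rho * ipm dz dz + / rho * ipm dy dy) / alpha.
Proof.
  (* Choosing the [v]-block inside [C] makes its projection trivial, so the dual vector at [s]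
     vanishes and only [c] remains. *)
  intros hc; set (s := join n (fun _ => 0) c).
  assert (hs : upper n s = c) by apply upper_join.
  assert (hp : veq m (pj s) c).
  { rewrite hs; apply proj_unique, (normal_proj m C); [exact hc|].
    intros; rewrite wip_sub_l; lra. }
  pose proof (Hmin s) as h; rewrite !wip_join in h.
  rewrite (wip_ext (vsub (admm_op proj prox s) s) (vscal alpha (vsub (xt s) s))
             delta delta) in h.
  2:{ intros i hi; unfold admm_op; cbv zeta; unfold vsub at 1.
      rewrite join_lower by exact hi; unfold vadd; ring. }
  2:{ intros i hi; reflexivity. }
  replace (upper n (vsub (admm_op proj prox s) s)) with (vscal alpha (vsub (zt s) (pj s)))
    in h.
  2:{ apply functional_extensionality; intros i.
      change (vscal alpha (vsub (zt s) (pj s)) i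
              = admm_op proj prox s (n + i)%nat - upper n s i).
      unfold admm_op; cbv zeta; rewrite join_upper; unfold vadd; ring. }
  pose proof (optimality_dx s) as ho.
  rewrite (wip_zero_r dz (dual s)) in ho by
    (intros i hi; unfold vscal, vsub; rewrite (hp i hi), hs; ring).
  rewrite dv_norm, !(wip_scal_l alpha) in h.
  assert (hy : ipm dy c = - ipm dy (vsub (zt s) (pj s))).
  { rewrite wip_sub_r, dy_image, (wip_ext dy dy (pj s) c); [ring| |exact hp].
    intros i hi; reflexivity. }
  rewrite hy, (wip_scal_l rho (vsub dv dz)), wip_sub_l.
  rewrite (wip_sym (vsub (xt s) s)), (wip_sym (vsub (zt s) (pj s))) in h.
  apply Rmult_le_reg_l with alpha; [lra|].
  replace (alpha * (- (sigma * ipn delta delta + rho * ipm dz dz + / rho * ipm dy dy) / alpha))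
    with (- (sigma * ipn delta delta + (rho * ipm dz dz + / rho * ipm dy dy)))
    by (field; lra).
  apply (Rmult_eq_compat_l alpha) in ho; lra.
Qed.

Lemma dy_support c : C c -> ipm dy c <= - (/ rho * ipm dy dy) / alpha.
Proof.
  intros hc; pose proof (displacement_bound c hc); pose proof q_dx_lower.
  unfold Rdiv in *; lra.
Qed.

(** The bound is applied with [c] running along the projections of a trajectory. As [dy] is
    orthogonal to the range of [A], the values [<dy, c>] tend to [- |dy|^2 / (alpha rho)], which
    cancels the [dy]-term. *)
Lemma q_dx_upper : ipn delta q <= - (sigma * ipn delta delta + rho * ipm dz dz) / alpha.
Proof.
  assert (h : Un_cv (fun k => ipm dy (vsub (zt (t0 k)) (pj (t0 k))))
                (ipm dy (vscal (/ alpha) dv))).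
  { apply wip_cv; [apply vcv_const|apply (zt_gap_cv t0 Ht0)]. }
  rewrite wip_scal_r, dy_dv in h.
  apply (Un_cv_ge _ _ (ipn delta q
     + (sigma * ipn delta delta + rho * ipm dz dz + / rho * ipm dy dy) / alpha)) in h.
  - unfold Rdiv in *; lra.
  - intros k; rewrite wip_sub_r, dy_image.
    pose proof (displacement_bound _ (proj1 (Hproj (upper n (t0 k))))).
    unfold Rdiv in *; lra.
Qed.

End Operator.

(** * From certificates to infeasibility, and the theorem *)

Lemma vnonzero_pos d u : vnonzero d u -> 0 < wip d ones u u.
Proof.
  intros [i [hi hne]]; pose proof (wip_ge_term (d := d) ones_pos u i hi) as h.
  unfold ones at 1 in h; nra.
Qed.

Lemma primal_certificate n m A C dy :
  veq n (mtv m n A dy) (fun _ => 0) -> support_neg m C dy -> ~ primal_feasible n m A C.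
Proof.
  intros hA [b [hb hsup]] [x hx].
  specialize (hsup _ hx); rewrite inner_wip, wip_sym, mv_adjoint in hsup.
  rewrite wip_zero_r in hsup by exact hA; lra.
Qed.

(** A finite support value at [y] forces [<y, A dx> <= 0] along recession rays; testing dual
    feasibility with [dx] then contradicts [q^T dx < 0]. *)
Lemma dual_certificate n m P q A C dx :
  psd n P -> nonemptyR C -> veq n (mv n n P dx) (fun _ => 0) ->
  in_recession_cone C (mv m n A dx) -> inner n q dx < 0 -> ~ dual_feasible n m P q A C.
Proof.
  intros HP [c hc] hP hrec hq [x [y [hxy [b hb]]]].
  assert (hle : inner m y (mv m n A dx) <= 0).
  { apply Rnot_lt_le; intros hlt; rewrite inner_wip in hlt.
    pose proof (hb c hc) as h0; rewrite inner_wip in h0.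
    set (g := wip m ones y (mv m n A dx)) in *; set (a := wip m ones y c) in *.
    (* This step length raises the inner product with [y] from [a] to [b + 1], beyond the supposed
       bound [b]. *)
    assert (ht : 0 <= (b - a + 1) / g) by (apply Rle_mult_inv_pos; lra).
    pose proof (hb _ (hrec c _ hc ht)) as h.
    change (inner m y (vadd c (vscal ((b - a + 1) / g) (mv m n A dx))) <= b) in h.
    rewrite inner_wip, wip_add_r, wip_scal_r in h; fold g a in h.
    replace ((b - a + 1) / g * g) with (b - a + 1) in h by (field; lra); lra. }
  rewrite inner_wip, wip_sym, mv_adjoint in hle; rewrite inner_wip, wip_sym in hq.
  pose proof (wip_ext (w := ones) dx dx _ _ (fun i _ => eq_refl) hxy) as h.
  change (wip n ones dx (vadd (vadd (mv n n P x) (mtv m n A y)) q)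
          = wip n ones dx (fun _ => 0)) in h.
  rewrite !wip_add_r in h.
  rewrite (wip_zero_r dx (fun _ => 0)) in h by (intros i hi; reflexivity).
  pose proof (psd_kernel_orthogonal n P dx x HP hP) as hPx.
  lra.
Qed.

Theorem theorem1 (n m : nat) (P : mat) (q : vec) (A : mat) (C : vec -> Prop)
  (rho sigma alpha : R) (mu nu : nat -> R) (x z y xt zt : nat -> vec)
  (HP : psd n P)
  (HCne : nonemptyR C) (HCcl : closedR m C) (HCcv : convexR C)
  (HCprod : compact_times_cone m C)
  (Hrho : 0 < rho) (Hsigma : 0 < sigma) (Halpha : 0 < alpha < 2)
  (Hmu : summable_nonneg mu) (Hnu : summable_nonneg nu)
  (Hiter : admm_iterates n m P q A C rho sigma alpha mu nu x z y xt zt) :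
  (* (a) *)
  ((exists xb zb yb, is_KKT n m P q A C xb zb yb) ->
   exists xb zb yb, vcv n x xb /\ vcv m z zb /\ vcv m y yb /\
                    is_KKT n m P q A C xb zb yb) /\
  (* (b) *)
  (exists dx dy : vec,
     vcv n (fun k i => x (S k) i - x k i) dx /\
     vcv m (fun k i => y (S k) i - y k i) dy /\
     (* (i) *)
     (vnonzero m dy ->
        ~ primal_feasible n m A C /\
        veq n (mtv m n A dy) (fun _ => 0) /\ support_neg m C dy) /\
     (* (ii) *)
     (vnonzero n dx ->
        ~ dual_feasible n m P q A C /\
        veq n (mv n n P dx) (fun _ => 0) /\
        in_recession_cone C (mv m n A dx) /\ inner n q dx < 0) /\
     (* (iii) *)
     (vnonzero n dx -> vnonzero m dy ->
        ~ primal_feasible n m A C /\ ~ dual_feasible n m P q A C /\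
        veq n (mtv m n A dy) (fun _ => 0) /\ support_neg m C dy /\
        veq n (mv n n P dx) (fun _ => 0) /\
        in_recession_cone C (mv m n A dx) /\ inner n q dx < 0)).
Proof.
  destruct (fun_choice _ (proj_exists m C HCne HCcl HCcv)) as [proj Hproj].
  destruct (fun_choice _ (fun xu => prox_exists n m P q A rho sigma HP Hrho Hsigma (fst xu) (snd xu)))
    as [prox Hprox].
  pose proof (admm_op_averaged n m P q A C rho sigma alpha HP HCcv Hrho Halpha
                proj prox Hproj Hprox) as HT.
  pose proof (join_weight_pos n sigma rho Hsigma Hrho) as HW.
  assert (Hbeta : 0 < (2 - alpha) / alpha) by (apply Rdiv_lt_0_compat; lra).
  set (st := iterate_state n rho x z y).
  set (T := admm_op n m A alpha proj prox) in *.
  destruct Hmu as [Hmu0 [lmu Hmu]]; apply summable_small_tails in Hmu.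
  destruct Hnu as [Hnu0 [lnu Hnu]]; apply summable_small_tails in Hnu.
  pose proof (fun k => iterate_inexact n m P q A C rho sigma alpha HP HCcv Hrho Hsigma Halpha
                proj prox Hproj Hprox mu nu x z y xt zt Hiter k) as Hst; fold T st in Hst.
  assert (Htails : small_tails (fun k => alpha * sqrt (sigma + rho) * mu (S k)
                                         + alpha * (3 * sqrt rho) * nu k)).
  { apply (small_tails_lin _ _ (fun k => mu (S k))).
    - apply Rmult_le_pos; [lra|apply sqrt_pos].
    - pose proof (sqrt_pos rho); apply Rmult_le_pos; lra.
    - apply small_tails_shift, Hmu.
    - exact Hnu. }
  set (u := fun k => vsub (z (S k)) (proj (upper n (st k)))).
  assert (Hu : vcv m u (fun _ => 0)).
  { apply (wnorm_vcv ones_pos), Un_cv_squeeze0 with nu; [|apply small_tails_cv; assumption].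
    intros k; rewrite Rabs_pos_eq by apply wnorm_nonneg.
    rewrite (wnorm_ext _ (u k)) by (intros i _; unfold vsub; ring).
    exact (iterate_z_error n m P q A C rho sigma alpha HCcv Hrho proj Hproj
             mu nu x z y xt zt Hiter k). }
  assert (Hx : forall k i, (i < n)%nat -> st k i = x (S k) i)
    by (intros; apply join_lower; assumption).
  assert (Hz : forall k i, z (S k) i = u k i + proj (upper n (st k)) i)
    by (intros; unfold u, vsub; ring).
  assert (Hy : forall k i, y (S k) i = rho * (upper n (st k) i - z (S k) i)).
  { intros; unfold st, iterate_state; rewrite upper_join; unfold vadd, vscal; field; lra. }
  split.
  - intros [xb [zb [yb hK]]].
    destruct (KKT_fixed_point n m P q A C rho sigma alpha HP HCcv Hrho Hsigma
                proj prox Hproj Hprox _ _ _ hK) as [f hf].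
    destruct (inexact_converges HW Hbeta HT st _ Htails Hst f hf) as [l [hl hTl]].
    assert (hup : vcv m (fun k => upper n (st k)) (upper n l))
      by (intros i hi; apply (hl (n + i)%nat); lia).
    assert (hpr : vcv m (fun k => proj (upper n (st k))) (proj (upper n l))).
    { apply (wnorm_vcv ones_pos), Un_cv_squeeze0 with
        (fun k => wnorm m ones (vsub (upper n (st k)) (upper n l))).
      - intros k; rewrite Rabs_pos_eq by apply wnorm_nonneg.
        apply (proj_nonexpansive m C HCcv); apply Hproj.
      - apply (vcv_wnorm ones_pos), hup. }
    assert (hz : vcv m (fun k => z (S k)) (proj (upper n l))).
    { intros i hi; apply Un_cv_ext with (fun k => u k i + proj (upper n (st k)) i);
        [intros; symmetry; apply Hz|].
      apply Un_cv_limit_ext with (0 + proj (upper n l) i); [|ring].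
      apply CV_plus; [apply Hu, hi|apply hpr, hi]. }
    exists l, (proj (upper n l)), (vscal rho (vsub (upper n l) (proj (upper n l)))).
    split; [|split; [|split]].
    + intros i hi; apply Un_cv_unshift, Un_cv_ext with (fun k => st k i);
        [intros; apply Hx, hi|apply hl; lia].
    + intros i hi; apply Un_cv_unshift, hz, hi.
    + intros i hi; apply Un_cv_unshift, Un_cv_ext with
        (fun k => rho * (upper n (st k) i - z (S k) i)); [intros; symmetry; apply Hy|].
      apply Un_cv_scal, CV_minus; [apply hup, hi|apply hz, hi].
    + exact (fixed_point_KKT n m P q A C rho sigma alpha HCcv Hrho Halpha
               proj prox Hproj Hprox l hTl).
  - destruct (minimal_displacement HW Hbeta HT) as [delta [hdelta hmin]].
    set (dy := vscal rho (vsub (upper n delta) (mv m n A delta))).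
    assert (hP : veq n (mv n n P delta) (fun _ => 0)) by
      exact (P_dx_zero n m P q A C rho sigma alpha HP HCcv Hrho Halpha
               proj prox Hproj Hprox delta hdelta).
    assert (hrec : in_recession_cone C (mv m n A delta)) by
      exact (dz_recession n m A C alpha HCcl HCcv Halpha proj prox Hproj delta hdelta).
    assert (hA : veq n (mtv m n A dy) (fun _ => 0)) by
      exact (At_dy_zero n m P q A C rho sigma alpha HP HCcv Hrho Halpha
               proj prox Hproj Hprox delta hdelta).
    assert (hi : vnonzero m dy -> ~ primal_feasible n m A C /\
                 veq n (mtv m n A dy) (fun _ => 0) /\ support_neg m C dy).
    { intros hnz; apply vnonzero_pos in hnz.
      assert (hs : support_neg m C dy).
      { exists (- (/ rho * wip m ones dy dy) / alpha); split.
        - assert (0 < / rho * wip m ones dy dy / alpha); [|unfold Rdiv in *; lra].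
          apply Rdiv_lt_0_compat; [apply Rmult_lt_0_compat|]; try lra.
          apply Rinv_0_lt_compat, Hrho.
        - intros c hc; rewrite inner_wip.
          exact (dy_support n m P q A C rho sigma alpha HP HCcl HCcv Hrho Halpha
                   proj prox Hproj Hprox delta hdelta hmin c hc). }
      split; [apply (primal_certificate n m A C dy hA hs)|split; assumption]. }
    assert (hii : vnonzero n delta -> ~ dual_feasible n m P q A C /\
                  veq n (mv n n P delta) (fun _ => 0) /\
                  in_recession_cone C (mv m n A delta) /\ inner n q delta < 0).
    { intros hnz; apply vnonzero_pos in hnz.
      assert (hq : inner n q delta < 0).
      { rewrite inner_wip, wip_sym.
        eapply Rle_lt_trans; [exact (q_dx_upper n m P q A C rho sigma alpha HP HCcv Hrho
          Halpha proj prox Hproj Hprox delta hdelta hmin)|].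
        pose proof (wip_nonneg (d := m) ones_pos (mv m n A delta)).
        assert (0 < (sigma * wip n ones delta delta
                     + rho * wip m ones (mv m n A delta) (mv m n A delta)) / alpha);
          [|unfold Rdiv in *; lra].
        apply Rdiv_lt_0_compat; nra. }
      split; [apply (dual_certificate n m P q A C delta); assumption|].
      split; [exact hP|split; [exact hrec|exact hq]]. }
    exists delta, dy; split; [|split; [|split; [exact hi|split; [exact hii|]]]].
    + pose proof (inexact_increment_cv HW Hbeta HT st _ Htails Hst delta hdelta) as h.
      intros i hin; apply Un_cv_unshift.
      apply Un_cv_ext with (fun k => increment st k i); [|apply h; lia].
      intros k; unfold increment, vsub; rewrite !Hx by exact hin; reflexivity.
    + pose proof (inexact_increment_cv HW Hbeta HT st _ Htails Hst delta hdelta) as h.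
      intros i him; apply Un_cv_unshift.
      (* Coordinates of the projection are Lipschitz functions of the state, so their increments
         along the iterates have the same limit as along exact trajectories. Then [y = rho (v - z)]
         and [z = u + proj v] with [u] vanishing give the limit [dy]. *)
      assert (hpr : Un_cv (fun k => proj (upper n (st (S k))) i - proj (upper n (st k)) i)
                      (mv m n A delta i)).
      { apply (inexact_increment HW Hbeta HT st _ Htails Hst (fun s => proj (upper n s) i)
                 (/ sqrt (ones i) * / sqrt rho)).
        - intros a b.
          eapply Rle_trans; [apply (coord_le_wnorm ones_pos
            (vsub (proj (upper n a)) (proj (upper n b))) i him)|].
          rewrite Rmult_assoc; apply Rmult_le_compat_l.
          + left; apply Rinv_0_lt_compat, sqrt_lt_R0, ones_pos.
          + eapply Rle_trans; [apply (proj_nonexpansive m C HCcv); apply Hproj|].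
            apply (upper_norm_le n m sigma rho (vsub a b) Hsigma Hrho).
        - intros t ht; exact (pj_increment_cv n m A alpha Halpha proj prox delta hdelta
                                t ht i him). }
      apply Un_cv_ext with (fun k => rho * (upper n (increment st k) i
        - ((proj (upper n (st (S k))) i - proj (upper n (st k)) i) + increment u k i))).
      * intros k; rewrite !Hy, !Hz; unfold increment, upper, vsub; ring.
      * apply Un_cv_scal, CV_minus; [apply (h (n + i)%nat); lia|].
        apply Un_cv_limit_ext with (mv m n A delta i + 0); [|ring].
        apply CV_plus; [exact hpr|apply (vcv_increment_zero _ _ _ Hu i him)].
    + intros h1 h2; destruct (hi h2) as [? [? ?]]; destruct (hii h1) as [? [? [? ?]]].
      repeat split; assumption.
Qed.
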